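(* Let $(\Sigma_A,T)$ be a topologically mixing subshift of finite type, $\Phi\in\mathcal C_{aa}(\Sigma_A,T,d)$ and $\Psi\in\mathcal C_{aa}^-(\Sigma_A,T)$. The function $\Lambda_\Phi^\Psi:L_\Phi\to\mathbb R$ is bounded, non-negative and weakly concave. It is continuous on any closed interval $I\subset L_\Phi$, and on $\mathrm{ri}(K)$ for any convex set $K\subset L_\Phi$; consequently it is continuous on $\mathrm{ri}(L_\Phi)$. If moreover $L_\Phi$ is a convex polyhedron, then $\Lambda_\Phi^\Psi$ is continuous on $L_\Phi$. Finally, if $I=[\alpha_0,\alpha_1]\subset L_\Phi$ and $\alpha_{\max}\in I$ is such that $\Lambda_\Phi^\Psi(\alpha_{\max})=\max\{\Lambda_\Phi^\Psi(\alpha):\alpha\in I\}$, then $\Lambda_\Phi^\Psi$ is non-increasing along the segment from $\alpha_{\max}$ to $\alpha_j$, for $j=0,1$.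
   Context: Subshift. $A$ is an $m\times m$ matrix with entries in $\{0,1\}$ such that $A^{p_0}$ has only positive entries for some $p_0\in\mathbb N$; $\Sigma_A=\{x\in\{1,\dots,m\}^{\mathbb N}:A(x_i,x_{i+1})=1\ \forall i\}$ with the product topology, $T$ is the shift, $\mathcal M(\Sigma_A,T)$ the set of $T$-invariant Borel probability measures. $|w|$ is the length of a word $w$, $[w]$ is the cylinder of points with prefix $w$. Potentials. $\Phi=(\phi_n)_{n\ge1}$ is in $\mathcal C_{aa}(\Sigma_A,T)$ (almost additive) if each $\phi_n:\Sigma_A\to\mathbb R$ is continuous and there is a constant $C(\Phi)>0$ with $-C(\Phi)+\phi_n+\phi_p\circ T^n\le\phi_{n+p}\le C(\Phi)+\phi_n+\phi_p\circ T^n$ for all $n,p$. $\mathcal C_{aa}(\Sigma_A,T,d)$ is the set of $\Phi=(\Phi^1,\dots,\Phi^d)$ with each $\Phi^j\in\mathcal C_{aa}(\Sigma_A,T)$, viewed as a sequence $(\phi_n)$ of $\mathbb R^d$-valued functions. $\Psi=(\psi_n)\in\mathcal C_{aa}^-(\Sigma_A,T)$ means $\Psi\in\mathcal C_{aa}(\Sigma_A,T)$ with $\max\psi_1+C(\Psi)<0$. $\Phi_*(\mu)=\lim_n\int\phi_n/n\,d\mu$, and $L_\Phi=\{\Phi_*(\mu):\mu\in\mathcal M(\Sigma_A,T)\}$ (a compact convex set). $\Psi[w]=\sup_{x\in[w]}\exp(\psi_{|w|}(x))$ (equal to $1$ for the empty word). $\mathcal B_n(\Psi)$ is the set of admissible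 words $w$ such that $[w]$ is a closed ball of radius $e^{-n}$ for the ultrametric $d_\Psi(x,y)=\Psi[x\wedge y]$ ($x\ne y$, $x\wedge y$ the longest common prefix), i.e. for $n\geq 1$ the words $w$ with $\Psi[w]\le e^{-n}$ and $\Psi[w']>e^{-n}$, where $w'$ is $w$ with its last letter deleted. For $\alpha\in L_\Phi$, $f(\alpha,n,\epsilon)$ is the number of $u\in\mathcal B_n(\Psi)$ for which some $x\in[u]$ satisfies $|\phi_{|u|}(x)/|u|-\alpha|<\epsilon$, and $\Lambda_\Phi^\Psi(\alpha)=\lim_{\epsilon\to0}\liminf_n\frac1n\log f(\alpha,n,\epsilon)=\lim_{\epsilon\to0}\limsup_n\frac1n\log f(\alpha,n,\epsilon)$ (the two coincide). Closed intervals are segments $[u,v]=\{tu+(1-t)v:0\le t\le1\}$, $u,v\in\mathbb R^d$. $\mathrm{ri}(K)$ is the relative interior of a convex set $K$. Continuity on a subset means continuity of the restriction to that subset. A function $h:K\to\mathbb R$ on a convex set $K\subset\mathbb R^d$ is weakly concave if there is $c\ge1$ such that for all $\alpha,\beta\in K$ there exist $\gamma_1,\gamma_2\in[c^{-1},c]$ (depending on $\alpha,\beta$) such that for all $\lambda\in[0,1]$, $\lambda h(\alpha)+(1-\lambda)h(\beta)\le h\Big(\frac{\lambda\gamma_1\alpha+(1-\lambda)\gamma_2\beta}{\lambda\gamma_1+(1-\lambda)\gamma_2}\Big)$. *)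

(* Defs.v *)
From HB Require Import structures.
From mathcomp Require Import all_boot all_order all_algebra.
From mathcomp Require Import all_classical all_reals all_analysis.
Import Order.TTheory GRing.Theory Num.Theory.
Import numFieldNormedType.Exports.

Set Implicit Arguments.
Unset Strict Implicit.
Unset Printing Implicit Defensive.

Local Open Scope classical_set_scope.
Local Open Scope ring_scope.

(** * Mixing subshifts of finite type *)

(* The alphabet {1, ..., m+1} is 'I_m.+1.  The exponent is required to be
   positive: A ^+ 0 = 1 is entrywise positive when m = 0, even for A = 0, whose
   subshift is empty. *)
Record mixing_mx (m : nat) := MixingMx {
  mixing_val :> 'M[nat]_m.+1 ;
  mixing_01 : forall i j, (mixing_val i j <= 1)%N ;
  mixing_primitive :
    exists2 p : nat, (0 < p)%N & forall i j, (0 < (mixing_val ^+ p) i j)%N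
}.

Definition full_shift (m : nat) : Type :=
  prod_topology (fun _ : nat => discrete_topology 'I_m.+1).
HB.instance Definition _ m := Topological.on (full_shift m).

Definition sft_set (m : nat) (A : mixing_mx m) : set (full_shift m) :=
  [set x | forall i : nat, A (x i) (x i.+1) = 1%N].

Definition sft (m : nat) (A : mixing_mx m) : Type := set_type (sft_set A).

HB.instance Definition _ m (A : mixing_mx m) := Topological.on (sft A).

(* MathComp-Analysis only allows measures on pointed types. *)
Lemma mixing_next (m : nat) (A : mixing_mx m) (i : 'I_m.+1) :
  exists j, A i j == 1%N.
Proof.
have [[//|p] _ /(_ i i)] := mixing_primitive A.
rewrite exprS mxE; apply: contraPP => /forallNP A0.
rewrite big1// => j _; have := mixing_01 A i j; have := A0 j.
by case: (mixing_val A i j) => [|[|]]//; rewrite mul0r.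
Qed.

Definition mixing_point (m : nat) (A : mixing_mx m) : full_shift m :=
  fun n => iter n (fun i => xchoose (mixing_next A i)) ord0.

Lemma mixing_pointP (m : nat) (A : mixing_mx m) :
  mixing_point A \in sft_set A.
Proof.
by apply/mem_set => i; apply/eqP; exact: (xchooseP (mixing_next A _)).
Qed.

HB.instance Definition _ m (A : mixing_mx m) :=
  isPointed.Build (sft A) (exist _ (mixing_point A) (mixing_pointP A)).

Definition letter (m : nat) (A : mixing_mx m) (x : sft A) (i : nat) : 'I_m.+1 :=
  (val x : full_shift m) i.

Lemma shift_subproof (m : nat) (A : mixing_mx m) (x : sft A) :
  (fun i => letter x i.+1) \in sft_set A.
Proof. by apply/mem_set => i; have /set_mem := valP x; apply. Qed.

Definition shift (m : nat) (A : mixing_mx m) (x : sft A) : sft A :=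
  exist _ (fun i => letter x i.+1) (shift_subproof x).

Definition borel_sft (m : nat) (A : mixing_mx m) :=
  g_sigma_algebraType (@open (sft A)).

Definition invariant (R : realType) (m : nat) (A : mixing_mx m)
    (mu : probability (borel_sft A) R) : Prop :=
  forall B : set (borel_sft A), measurable B -> mu (@shift m A @^-1` B) = mu B.

(** * Almost additive potentials *)

(* Potentials are indexed from 1; [phi 0] is never constrained. *)
Definition almost_additive_with (R : realType) (m : nat) (A : mixing_mx m)
    (C : R) (phi : nat -> sft A -> R) : Prop :=
  [/\ 0 < C,
      forall n, (0 < n)%N -> continuous (phi n) &
      forall n p x, (0 < n)%N -> (0 < p)%N ->
        - C + phi n x + phi p (iter n (@shift m A) x) <= phi (n + p)%N x
          <= C + phi n x + phi p (iter n (@shift m A) x)].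

Definition almost_additive (R : realType) (m : nat) (A : mixing_mx m)
    (phi : nat -> sft A -> R) : Prop :=
  exists C : R, almost_additive_with C phi.

Definition neg_almost_additive (R : realType) (m : nat) (A : mixing_mx m)
    (psi : nat -> sft A -> R) : Prop :=
  exists2 C : R, almost_additive_with C psi & sup (range (psi 1%N)) + C < 0.

Definition vec_potential (R : realType) (m d : nat) (A : mixing_mx m)
    (Phi : 'I_d.+1 -> nat -> sft A -> R) (n : nat) (x : sft A) : 'rV[R]_d.+1 :=
  \row_j Phi j n x.

Definition Phi_star (R : realType) (m d : nat) (A : mixing_mx m)
    (Phi : 'I_d.+1 -> nat -> sft A -> R) (mu : probability (borel_sft A) R)
    : 'rV[R]_d.+1 :=
  limn (fun n : nat =>
    \row_j \int[mu]_(x in [set: borel_sft A]) (Phi j n x / n%:R) : 'rV[R]_d.+1).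

Definition L_Phi (R : realType) (m d : nat) (A : mixing_mx m)
    (Phi : 'I_d.+1 -> nat -> sft A -> R) : set 'rV[R]_d.+1 :=
  [set Phi_star Phi mu | mu in [set mu | invariant mu]].

(** * Words and the function Lambda *)

Definition admissible (m : nat) (A : mixing_mx m) (w : seq 'I_m.+1) : bool :=
  sorted (fun i j => A i j == 1%N) w.

Definition cylinder (m : nat) (A : mixing_mx m) (w : seq 'I_m.+1) : set (sft A) :=
  [set x | mkseq (letter x) (size w) = w].
Arguments cylinder {m} A w.

Definition word_weight (R : realType) (m : nat) (A : mixing_mx m)
    (psi : nat -> sft A -> R) (w : seq 'I_m.+1) : R :=
  if w is [::] then 1
  else sup [set expR (psi (size w) x) | x in cylinder A w].

(* Used for n >= 1 only, where Psi[empty word] = 1 > e^-n already excludes the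
   empty word. [take (size w).-1 w] is w without its last letter. *)
Definition ball_words (R : realType) (m : nat) (A : mixing_mx m)
    (psi : nat -> sft A -> R) (n : nat) : set (seq 'I_m.+1) :=
  [set w | [/\ admissible A w, word_weight psi w <= expR (- n%:R) &
               expR (- n%:R) < word_weight psi (take (size w).-1 w)]].

(* [`|_|] is the sup norm of R^d; the choice of a norm does not affect the
   limit eps -> 0. *)
Definition level_words (R : realType) (m d : nat) (A : mixing_mx m)
    (Phi : 'I_d.+1 -> nat -> sft A -> R) (psi : nat -> sft A -> R)
    (alpha : 'rV[R]_d.+1) (n : nat) (eps : R) : set (seq 'I_m.+1) :=
  [set u | ball_words psi n u /\
     exists2 x, cylinder A u x &
       `| (size u)%:R^-1 *: vec_potential Phi (size u) x - alpha | < eps].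

(* Extended-real valued, so that log 0 = -oo and no finiteness is presupposed.
   Lambda is defined through the liminf in n; the limsup gives the same limit as
   eps -> 0. *)
Definition growth_rate (R : realType) (m d : nat) (A : mixing_mx m)
    (Phi : 'I_d.+1 -> nat -> sft A -> R) (psi : nat -> sft A -> R)
    (alpha : 'rV[R]_d.+1) (eps : R) : \bar R :=
  limn_einf (fun n : nat =>
    (n%:R^-1)%:E * lne (counting (level_words Phi psi alpha n eps)))%E.

Definition Lambda_ext (R : realType) (m d : nat) (A : mixing_mx m)
    (Phi : 'I_d.+1 -> nat -> sft A -> R) (psi : nat -> sft A -> R)
    (alpha : 'rV[R]_d.+1) : \bar R :=
  lim (growth_rate Phi psi alpha eps @[eps --> 0^'+]).

Definition Lambda (R : realType) (m d : nat) (A : mixing_mx m)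
    (Phi : 'I_d.+1 -> nat -> sft A -> R) (psi : nat -> sft A -> R)
    (alpha : 'rV[R]_d.+1) : R :=
  fine (Lambda_ext Phi psi alpha).

(** * Convexity in R^d *)

Definition segment (R : realType) (d : nat) (u v : 'rV[R]_d) : set 'rV[R]_d :=
  [set t *: u + (1 - t) *: v | t in `[0, 1]].

Definition affine_hull (R : realType) (d : nat) (K : set 'rV[R]_d)
    : set 'rV[R]_d :=
  [set x | exists (k : nat) (p : 'I_k -> 'rV[R]_d) (c : 'I_k -> R),
     [/\ forall i, K (p i), \sum_i c i = 1 & x = \sum_i c i *: p i]].

Definition rel_interior (R : realType) (d : nat) (K : set 'rV[R]_d)
    : set 'rV[R]_d :=
  [set x | K x /\ exists2 e : R, 0 < e & ball x e `&` affine_hull K `<=` K].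

Definition is_polyhedron (R : realType) (d : nat) (K : set 'rV[R]_d) : Prop :=
  exists (k : nat) (a : 'I_k -> 'rV[R]_d) (b : 'I_k -> R),
    K = [set x | forall i, \sum_j a i 0 j * x 0 j <= b i].

Definition weakly_concave (R : realType) (d : nat) (K : set 'rV[R]_d)
    (h : 'rV[R]_d -> R) : Prop :=
  exists2 c : R, 1 <= c &
    forall alpha beta, K alpha -> K beta ->
      exists g1 g2 : R,
        [/\ c^-1 <= g1 <= c, c^-1 <= g2 <= c &
            forall t : R, 0 <= t <= 1 ->
              t * h alpha + (1 - t) * h beta <=
              h ((t * g1 + (1 - t) * g2)^-1 *:
                 ((t * g1) *: alpha + ((1 - t) * g2) *: beta))].

Definition nonincreasing_along (R : realType) (d : nat)
    (h : 'rV[R]_d -> R) (u v : 'rV[R]_d) : Prop :=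
  forall s t : R, 0 <= s -> s <= t -> t <= 1 ->
    h ((1 - t) *: u + t *: v) <= h ((1 - s) *: u + s *: v).

(* Main.v *)
Require Import Defs.
From HB Require Import structures.
From mathcomp Require Import all_boot all_order all_algebra.
From mathcomp Require Import all_classical all_reals all_analysis.
From mathcomp Require Import measurable_realfun.
From mathcomp Require Import ring lra zify.
Import Order.TTheory GRing.Theory Num.Theory.
Import numFieldNormedType.Exports.

Set Implicit Arguments.
Unset Strict Implicit.
Unset Printing Implicit Defensive.

Local Open Scope classical_set_scope.
Local Open Scope ring_scope.

(* Points of the subshift can be glued with a gap of bounded length, and an
   almost additive potential varies by o(n) on cylinders of length n.  Hence a
   concatenation of p_i orbit segments of type i carries, for every potential,
   the weighted sum of the values of its pieces up to a small relative error,
   and extending it until its Psi-weight drops below e^-N costs few letters.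
   This single growth estimate is used twice.

   - Given invariant mu, take the words w of a large length k with frequencies
     mu[w]: every neighbourhood of Phi_*(mu) contains averages along words of
     B_N(Psi) for all large N, so Lambda >= 0 on L_Phi.
   - Given alpha and beta, the pigeonhole principle provides many words of
     level alpha (resp. beta) in B_n(Psi) of a common length l1 (resp. l2).
     Mixing the two kinds with frequencies t and 1 - t gives weak concavity,
     gamma_i being a cluster value of l_i / n, independent of t.

   Upper semicontinuity of Lambda is immediate from its definition.  Lower
   semicontinuity at x0 relative to a set S follows from weak concavity as soon
   as the segments from x0 to nearby points of S extend inside L_Phi to a length
   bounded below; segments, relative interiors and polyhedra have this property. *)

(** Words of [ball_words psi n] have a prescribed weight but no prescribed length, whereas averages
    are taken over the length and counts over n. Blocks of levels alpha and beta built at the same n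
    spend the same budget n of [- psi]. In a concatenation with frequencies t and 1 - t the
    logarithms of their numbers therefore combine with weights t and 1 - t, but their averages
    combine with weights proportional to t * l1 and (1 - t) * l2. This mismatch is the source of the
    factors gamma_i, and n / B <= l <= n / kappa + 1 gives their uniform bound. The value
    [Lambda_ext] stays extended-real as long as possible: the growth estimate bounds it from below
    at the mixed point, and only then is [fine] known to lose nothing there. *)

Section RowNorm.
Variables (R : realType) (n : nat).

Lemma mx_norm_coord (v : 'rV[R]_n.+1) j : `|v 0 j| <= `|v|.
Proof.
rewrite [leRHS]/Num.norm/= mx_normrE.
exact: (le_bigmax _ (fun ij => `|v ij.1 ij.2|) (0, j)).
Qed.

Lemma mx_norm_ltP (v : 'rV[R]_n.+1) (e : R) : (forall j, `|v 0 j| < e) -> `|v| < e.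
Proof.
move=> h; have e0 : 0 < e by apply: le_lt_trans (h ord0).
rewrite /Num.norm/= mx_normrE; apply/bigmax_ltP; split=> //= -[i j] _ /=.
by rewrite (ord1 i).
Qed.

End RowNorm.

Lemma near_natr (R : realType) (r : R) : \forall n \near \oo, r <= n%:R.
Proof.
exists (Num.truncn r).+1 => // n /= rn.
by apply: (@le_trans _ _ (Num.truncn r).+1%:R); rewrite ?ler_nat// ltW// truncnS_gt.
Qed.

(** * The topology of the subshift *)

Local Notation sh := (fun n => iter n (@Defs.shift _ _)).

Section Subshift.
Variables (m : nat) (A : mixing_mx m).
Implicit Types (x y z : sft A) (r n : nat).

Definition agree r x y := forall i, (i < r)%N -> letter x i = letter y i.

Lemma agree_refl r x : agree r x x. Proof. by []. Qed.

Lemma agree_sym r x y : agree r x y -> agree r y x.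
Proof. by move=> h i /h. Qed.

Lemma agree_trans r x y z : agree r x y -> agree r y z -> agree r x z.
Proof. by move=> xy yz i ir; rewrite xy// yz. Qed.

Lemma agree_leq r n x y : (r <= n)%N -> agree n x y -> agree r x y.
Proof. by move=> rn h i ir; apply: h; apply: leq_trans ir rn. Qed.

Lemma letter_iter n x i : letter (sh n x) i = letter x (n + i)%N.
Proof. by elim: n i => // n IH i; rewrite iterS [LHS]IH addnS. Qed.

Lemma agree_shift r n x y : agree (n + r)%N x y ->
  agree r (sh n x) (sh n y).
Proof. by move=> h i ir; rewrite !letter_iter h// ltn_add2l. Qed.

Lemma sft_ext x y : (forall i, letter x i = letter y i) -> x = y.
Proof. by move=> h; apply: val_inj; apply: funext => i; exact: h. Qed.

Lemma agree_nbhs x r : nbhs x (agree r^~ x).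
Proof.
elim: r => [|r IH]; first by apply: filterS filterT => y _ i.
have : nbhs x [set y | letter y r = letter x r].
  have c1 : continuous (val : sft A -> full_shift m) by exact: initial_continuous.
  have c2 : continuous (fun y : full_shift m => y r : discrete_topology 'I_m.+1).
    exact: (@proj_continuous nat (fun=> discrete_topology 'I_m.+1) r).
  have c3 : {for x, continuous
      (fun y : sft A => (val y : full_shift m) r : discrete_topology 'I_m.+1)}.
    exact: (continuous_comp (@c1 x) (@c2 _)).
  apply: (c3 [set i | i = letter x r]); rewrite nbhs_principalE; exact/principal_filterP.
move=> h; apply: filterS (filterI IH h) => y [h1 h2] i.
by rewrite ltnS leq_eqVlt => /predU1P[->//|/h1].
Qed.

Lemma cvg_agree (u : nat -> sft A) x :
  (forall r, \forall n \near \oo, agree r (u n) x) -> u @ \oo --> x.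
Proof.
move=> h.
have cvgK : (fun n => val (u n) : full_shift m) @ \oo --> (val x : full_shift m).
  apply/cvg_sup => i U; rewrite nbhsE => -[V [[W _ <-] Wx] VU].
  rewrite nbhs_filterE; apply: filterS VU _; apply: filterS (h i.+1) => n hn.
  by move: Wx; rewrite /preimage/=; have /= := hn i (ltnSn i); rewrite /letter => ->.
move=> U; rewrite nbhsE => -[V [[W oW <-] Wx] VU].
have WK : nbhs (val x : full_shift m) W by exact: open_nbhs_nbhs.
by have h1 := cvgK _ WK; apply: filterS VU h1.
Qed.

(** If [U] contained no cylinder around [x], points chosen outside [U] in ever longer cylinders
    would converge to [x]. *)
Lemma nbhs_sftP x (U : set (sft A)) :
  nbhs x U <-> exists r, forall y, agree r y x -> U y.
Proof.
split=> [xU|[r rU]]; last by apply: filterS (agree_nbhs x r).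
apply: contrapT => /forallNP nU.
have {nU} /choice[u hu] : forall r, exists y, agree r y x /\ ~ U y.
  by move=> r; have /existsNP[y /not_implyP] := nU r; exists y.
have : u @ \oo --> x.
  apply: cvg_agree => r; exists r => // n /= rn.
  exact: agree_leq rn (hu n).1.
by move=> /(_ _ xU)[N _ /(_ N (leqnn N))]; have [_] := hu N.
Qed.

(** Sequential compactness in combinatorial form. Tychonoff's theorem gives a cluster point in the
    full shift; each of its transitions is one of some [u k], so it lies in the subshift. *)
Lemma sft_cluster (u : nat -> sft A) :
  exists x, forall r n, exists2 k, (n <= k)%N & agree r (u k) x.
Proof.
have cT : compact [set f : full_shift m | forall i, [set: discrete_topology 'I_m.+1] (f i)].
  apply: (@tychonoff nat (fun=> discrete_topology 'I_m.+1) (fun=> setT)) => i.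
  apply: finite_compact; exact: (@finite_finset 'I_m.+1).
pose F := (fun n => val (u n) : full_shift m) @ \oo.
have [x [_ clx]] : [set f | forall i, [set: discrete_topology 'I_m.+1] (f i)] `&` cluster F !=set0.
  by apply: cT; exists 0%N.
have cyl r : nbhs (x : full_shift m) [set y : full_shift m | forall i, (i < r)%N -> y i = x i].
  elim: r => [|r IH]; first by apply: filterS filterT => y _ i.
  have h : nbhs (x : full_shift m) [set y : full_shift m | y r = x r].
    apply: (@proj_continuous nat (fun=> discrete_topology 'I_m.+1) r x [set i | i = x r]).
    rewrite nbhs_principalE; exact/principal_filterP.
  apply: filterS (filterI IH h) => y [h1 h2] i.
  by rewrite ltnS leq_eqVlt => /predU1P[->//|/h1].
have h r n : exists2 k, (n <= k)%N & forall i, (i < r)%N -> letter (u k) i = x i.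
  have : ((fun n => val (u n) : full_shift m) @ \oo) (val @` (u @` [set k | (n <= k)%N])).
    by exists n => // k /= nk; exists (u k) => //; exists k.
  move=> /clx /(_ (cyl r)) [_ [[_ [k nk <-] <-] hk]].
  by exists k.
have Xx : x \in sft_set A.
  apply/mem_set => i; have [k _ hk] := h i.+2 0%N.
  by rewrite -!hk//; have /set_mem/(_ i) := valP (u k).
by exists (exist _ x Xx) => r n; exact: h.
Qed.

End Subshift.

(** * Gluing of orbit segments *)

Section Glue.
Variables (m : nat) (A : mixing_mx m).

Let e : rel 'I_m.+1 := fun i j => A i j == 1%N.

(** A positive entry of a product has a positive summand, whose index is the next letter of the
    path. *)
Lemma path_of_power p i j : (0 < (mixing_val A ^+ p.+1) i j)%N ->
  exists2 c, size c = p & path e i (rcons c j).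
Proof.
elim: p i => [|p IH] i.
  rewrite expr1 => Aij; exists [::] => //=; rewrite andbT /e.
  by rewrite eqn_leq mixing_01.
rewrite exprS mxE => h.
have [k hk] : exists k, (0 < mixing_val A i k * (mixing_val A ^+ p.+1) k j)%N.
  apply: contrapT => /forallNP A0; move: h; rewrite big1// => k _.
  rewrite -[LHS]/(mixing_val A i k * (mixing_val A ^+ p.+1) k j)%N.
  by case: (_ * _)%N (A0 k) => // a /(_ isT).
move: hk; rewrite muln_gt0 => /andP[Aik /IH[c sc pc]].
exists (k :: c); rewrite /= ?sc// pc andbT /e.
by rewrite eqn_leq mixing_01.
Qed.

(** The exponent of primitivity serves all pairs of letters at once, so the gap depends neither on
    the points nor on the place where they are joined. *)
Lemma gluing : exists q, forall l (x y : sft A),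
  exists2 z, agree l z x & sh (l + q)%N z = y.
Proof.
have [[//|q] _ Aq] := mixing_primitive A.
exists q => l x y.
(* For [l = 0] the path starts at [letter x 0], which is not copied into [z]; only the later letters
   of the path are used. *)
have [c sc pc] := path_of_power (Aq (letter x l.-1) (letter y 0)).
pose u := rcons c (letter y 0).
pose f i := if (i < l)%N then letter x i
  else if (i <= l + q)%N then nth ord0 u (i - l) else letter y (i - (l + q)).
have fy i : f (l + q + i)%N = letter y i.
  rewrite /f; case: ltnP => [|_]; first lia.
  case: leqP => [h|_]; last by congr (letter y _); lia.
  have -> : (l + q + i - l = q)%N by lia.
  by rewrite /u nth_rcons sc ltnn eqxx; congr (letter y _); lia.
have Af i : A (f i) (f i.+1) = 1%N.
  have Ax (v : sft A) k : A (letter v k) (letter v k.+1) = 1%N.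
    by have /set_mem := valP v; exact.
  have [il|li] := ltnP i.+1 l; first by rewrite /f il (ltnW il) Ax.
  have [ilq|] := leqP (l + q)%N i.
    by rewrite -(subnKC ilq) -addnS !fy Ax.
  move=> ilq; have /(pathP ord0)/(_ (i.+1 - l)%N) := pc.
  rewrite size_rcons sc => /(_ ltac:(lia))/eqP; rewrite -/u => <-.
  have -> : f i.+1 = nth ord0 u (i.+1 - l).
    by rewrite /f; case: ltnP => [|_]; [lia|rewrite ilq].
  (* Here [i < l] forces [i.+1 = l]: the transition leaves the last letter taken from [x]. *)
  congr (mixing_val A _ _); rewrite /f; case: ltnP => il.
    have -> : (i.+1 - l = 0)%N by lia.
    by rewrite /=; congr (letter x _); lia.
  by rewrite ltnW// subSn.
exists (exist _ (f : full_shift m) (mem_set Af)).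
  by move=> i il; rewrite /letter/= /f il.
by apply: sft_ext => i; rewrite letter_iter; exact: fy.
Qed.

End Glue.

(** * Almost additive potentials *)

Section Potentials.
Variables (R : realType) (m : nat) (A : mixing_mx m).
Implicit Types (x y z : sft A) (phi psi : nat -> sft A -> R) (g : sft A -> R).

Lemma continuous_agree g z (e : R) : continuous g -> 0 < e ->
  exists r, forall w, agree r w z -> `|g z - g w| < e.
Proof.
move=> cg e0; apply/nbhs_sftP.
by move: (cg z) => /cvgrPdist_lt /(_ e e0).
Qed.

Lemma continuous_unif g (e : R) : continuous g -> 0 < e ->
  exists r, forall x y, agree r x y -> `|g x - g y| <= e.
Proof.
move=> cg e0; apply: contrapT => /forallNP nr.
have {nr}/choice[u hu] : forall r, exists p : sft A * sft A,
    agree r p.1 p.2 /\ ~ (`|g p.1 - g p.2| <= e).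
  move=> r; have /existsNP[x /existsNP[y /not_implyP[? ?]]] := nr r.
  by exists (x, y).
have [z clz] := sft_cluster (fun n => (u n).1).
have e20 : 0 < e / 2 by rewrite divr_gt0.
have [r hr] := continuous_agree z cg e20.
have [k rk k1] := clz r r.
have [k2 []] := hu k.
have h1 := hr _ k1.
have h2 := hr _ (agree_trans (agree_sym (agree_leq rk k2)) k1).
rewrite (le_trans (ler_distD (g z) _ _))// (splitr e) lerD// ltW//.
by rewrite distrC.
Qed.

Lemma continuous_bounded g : continuous g -> exists B, forall x, `|g x| <= B.
Proof.
move=> cg; apply: contrapT => /forallNP nr.
have {nr}/choice[u hu] : forall n, exists x, ~ (`|g x| <= n%:R).
  by move=> n; have /existsNP[x ?] := nr n%:R; exists x.
have [z clz] := sft_cluster u.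
have [r hr] := continuous_agree z cg ltr01.
have [k zk k1] := clz r (Num.truncn (`|g z| + 1)).+1.
apply: (hu k); have h1 := hr _ k1.
have : `|g (u k)| <= `|g z| + 1.
  rewrite -[g (u k)](subrK (g z)) addrC (le_trans (ler_normD _ _))//.
  by rewrite lerD2l distrC ltW.
move/le_trans; apply; have := truncnS_gt (`|g z| + 1).
by move=> /ltW/le_trans; apply; rewrite ler_nat.
Qed.

(** [C] prices each cut of an orbit segment, and the linear bound [B] prices the letters inserted by
    gluing or added by extension. *)
Definition aapot (C B : R) phi : Prop :=
  [/\ forall x, phi 0%N x = 0,
      forall n p x, `|phi (n + p)%N x - (phi n x + phi p (sh n x))| <= C &
      forall n x, `|phi n x| <= B * n%:R].

Lemma aapot_leq (C B C' B' : R) phi :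
  C <= C' -> B <= B' -> aapot C B phi -> aapot C' B' phi.
Proof.
move=> CC BB [p0 pa pb]; split=> // [n p x|n x]; first exact: le_trans (pa n p x) CC.
by apply: le_trans (pb n x) _; rewrite ler_wpM2r.
Qed.

(** Length is treated as one more potential, so that the estimates on concatenations also control
    their length. *)
Lemma aapot_length : aapot 0 1 (fun n _ => n%:R).
Proof.
split=> [//|n p x|n x]; first by rewrite natrD subrr normr0.
by rewrite mul1r ger0_norm.
Qed.

(* The unconstrained value at index 0 is reset so that quasi-additivity holds for
   all indices. *)
Definition norm0 phi n x : R := if n is 0%N then 0 else phi n x.

Lemma norm0_aapot (C : R) phi : almost_additive_with C phi ->
  exists B, aapot C B (norm0 phi).
Proof.
move=> [C0 cphi phiD].
have [B1 hB1] := continuous_bounded (cphi 1%N isT).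
have aa n p x : `|norm0 phi (n + p)%N x - (norm0 phi n x + norm0 phi p (sh n x))| <= C.
  case: n => [|n]; first by rewrite add0n/= add0r subrr normr0 ltW.
  case: p => [|p]; first by rewrite addn0/= addr0 subrr normr0 ltW.
  have /andP[h1 h2] := phiD n.+1 p.+1 x isT isT.
  rewrite /norm0 addSn -addSn ler_norml; apply/andP; split; lra.
exists (B1 + C); split=> // n x.
(* Each further letter costs at most the bound on [phi 1] and one defect [C]. *)
elim: n x => [|n IH] x; first by rewrite mulr0 normr0.
have h1 := aa n 1%N x; rewrite addn1 in h1.
have h2 := hB1 (sh n x); have h3 := IH x.
rewrite -natr1 mulrDr mulr1.
move: h1 h2 h3; rewrite /= !ler_norml.
set a := norm0 phi n x; set b := phi 1%N _; set c := phi n.+1 x; set D := (_ * _).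
by move=> /andP[? ?] /andP[? ?] /andP[? ?]; apply/andP; split; lra.
Qed.

(** Pieces of a fixed length [k] are cut off one by one. Each cut costs two defects [C] and the
    variation 1 of [phi k], in all at most [delta * k]; the last [k + r] letters are bounded crudely
    by [D]. Cutting stops there because [r] letters of agreement are needed to control [phi k]. *)
Lemma aapot_var (C B : R) phi : aapot C B phi ->
  (forall n, exists r, forall x y, agree r x y -> `|phi n x - phi n y| <= 1) ->
  forall delta, 0 < delta -> exists2 D, 0 <= D &
    forall n x y, agree n x y -> `|phi n x - phi n y| <= delta * n%:R + D.
Proof.
move=> [p0 pa pb] pu delta delta0.
have C0 : 0 <= C by apply: le_trans (pa 0%N 0%N point).
have B0 : 0 <= B by have := pb 1%N point; rewrite mulr1; exact: le_trans.
pose k := (Num.truncn ((2 * C + 1) / delta)).+1.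
have hk : 2 * C + 1 <= delta * k%:R.
  by rewrite [leRHS]mulrC -ler_pdivrMr// ltW// /k truncnS_gt.
have [r hr] := pu k.
have D0 : 0 <= 2 * B * (k + r)%:R by rewrite !mulr_ge0.
exists (2 * B * (k + r)%:R) => //.
elim/ltn_ind => n IH x y xy.
have [nkr|krn] := ltnP n (k + r).
  rewrite (le_trans (ler_normB _ _))// (le_trans (lerD (pb _ _) (pb _ _)))//.
  have h1 : B * n%:R <= B * (k + r)%:R by rewrite ler_wpM2l// ler_nat ltnW.
  have h2 : 0 <= delta * n%:R by rewrite mulr_ge0// ltW.
  by rewrite -mulrA; lra.
have kn : (k <= n)%N by apply: leq_trans krn; exact: leq_addr.
have h1 : `|phi k x - phi k y| <= 1 by apply: hr; apply: agree_leq xy; lia.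
have h2 : `|phi (n - k)%N (sh k x) - phi (n - k)%N (sh k y)| <=
    delta * (n - k)%:R + 2 * B * (k + r)%:R.
  by apply: IH; [rewrite /k; lia|apply: agree_shift; rewrite subnKC].
have := pa k (n - k)%N x; have := pa k (n - k)%N y.
move: h1 h2; rewrite subnKC// natrB// mulrBr.
move: (delta * k%:R) hk => dk hk; move: (delta * n%:R) (2 * B * _) => dn D.
rewrite !ler_norml => /andP[? ?] /andP[? ?] /andP[? ?] /andP[? ?].
by apply/andP; split; lra.
Qed.

Lemma norm0_unif phi : (forall n, (0 < n)%N -> continuous (phi n)) ->
  forall n, exists r, forall x y, agree r x y -> `|norm0 phi n x - norm0 phi n y| <= 1.
Proof.
move=> cphi [|n]; first by exists 0%N => x y _; rewrite subrr normr0.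
by have [r hr] := continuous_unif (cphi n.+1 isT) (@ltr01 R); exists r.
Qed.

(** One more letter increases [psi] by at most [psi 1] at a shifted point plus [C]; the strict
    negativity of this bound is the margin [kappa]. The case [n = 0] uses [0 < C]. *)
Lemma norm0_decr (C : R) psi : almost_additive_with C psi ->
  sup (range (psi 1%N)) + C < 0 ->
  exists2 kappa, 0 < kappa & forall n x, norm0 psi n.+1 x <= norm0 psi n x - kappa.
Proof.
move=> [C0 cpsi psiD] h; exists (- (sup (range (psi 1%N)) + C)); first by rewrite oppr_gt0.
have [B hB] := continuous_bounded (cpsi 1%N isT).
have s1 x : psi 1%N x <= sup (range (psi 1%N)).
  apply: ub_le_sup; last by exists x.
  by exists B => _ [y _ <-]; exact: le_trans (ler_norm _) (hB y).
move=> [|n] x; first by have := s1 x; rewrite /norm0; lra.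
have /andP[_] := psiD n.+1 1%N x isT isT.
by have := s1 (sh n.+1 x); rewrite /norm0 addn1; lra.
Qed.

End Potentials.

(** * Blocks of points and their concatenation *)

Section Blocks.
Variables (R : realType) (m : nat) (A : mixing_mx m).
Implicit Types (x y z : sft A) (phi psi : nat -> sft A -> R).

(* A block stands for a finite set of words of length [blen], each given by a
   point of its cylinder; this spares admissibility conditions. *)
Record block := Block {
  bidx : finType ;
  bpt : bidx -> sft A ;
  blen : nat ;
  binj : forall i j, agree blen (bpt i) (bpt j) -> i = j }.
Arguments bpt : clear implicits.

(** The bound is asked on the whole cylinder because gluing replaces the representative by another
    point of it. *)
Definition approx phi (b : block) (a e : R) : Prop :=
  forall i z, agree (blen b) z (bpt b i) -> `|phi (blen b) z - a| <= e.

(** The glued word determines both pieces, read at the positions 0 and [blen b1 + q], so cardinals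
    multiply. The added error comes from two cuts and a gap of [q] letters. *)
Lemma block_cat : exists q, forall b1 b2 : block, exists2 b : block,
  #|bidx b| = (#|bidx b1| * #|bidx b2|)%N &
  forall phi (C B a1 e1 a2 e2 : R), aapot C B phi ->
    approx phi b1 a1 e1 -> approx phi b2 a2 e2 ->
    approx phi b (a1 + a2) (e1 + e2 + (2 * C + B * q%:R)).
Proof.
have [q glue] := gluing A; exists q => b1 b2.
have {glue}/choice[g gP] : forall p : bidx b1 * bidx b2, exists z,
    agree (blen b1) z (bpt b1 p.1) /\ sh (blen b1 + q)%N z = bpt b2 p.2.
  by move=> p; have [z ? ?] := glue (blen b1) (bpt b1 p.1) (bpt b2 p.2); exists z.
have agree1 z p : agree (blen b1 + q + blen b2)%N z (g p) ->
    agree (blen b1) z (bpt b1 p.1).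
  by move=> h; apply: agree_trans (gP p).1; apply: agree_leq h; lia.
have agree2 z p : agree (blen b1 + q + blen b2)%N z (g p) ->
    agree (blen b2) (sh (blen b1 + q)%N z) (bpt b2 p.2).
  by move=> h; rewrite -(gP p).2; exact: agree_shift.
have ginj p p' : agree (blen b1 + q + blen b2)%N (g p) (g p') -> p = p'.
  case: p p' => [p1 p2] [p1' p2'] h; congr pair.
    by apply: (@binj b1); exact: agree_trans (agree_sym (gP _).1) (agree1 _ _ h).
  by apply: (@binj b2); have := agree2 _ _ h; rewrite (gP _).2.
exists (Block ginj); first by rewrite card_prod.
move=> phi C B a1 e1 a2 e2 [p0 pa pb] h1 h2 p z /= zp.
have := h1 _ _ (agree1 _ _ zp); have := h2 _ _ (agree2 _ _ zp).
have := pa (blen b1) q z; have := pb q (sh (blen b1) z).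
have := pa (blen b1 + q)%N (blen b2) z.
move: (B * _) => Bq; rewrite !ler_norml.
by move=> /andP[? ?] /andP[? ?] /andP[? ?] /andP[? ?] /andP[? ?]; apply/andP; split; lra.
Qed.

Lemma block_cats : exists q, forall (I : Type) (blk : I -> block) (s : seq I),
  exists2 b : block, #|bidx b| = (\prod_(i <- s) #|bidx (blk i)|)%N &
  forall phi (C B : R) (a e : I -> R), aapot C B phi ->
    (forall i, approx phi (blk i) (a i) (e i)) ->
    approx phi b (\sum_(i <- s) a i) (\sum_(i <- s) (e i + (2 * C + B * q%:R))).
Proof.
have [q cat] := block_cat; exists q => I blk; elim=> [|i s [b cb hb]].
  (* The empty concatenation is one point of length 0; its potentials vanish because of the
     normalisation at index 0. *)
  have inj0 : forall i j : unit, agree 0 (point : sft A) point -> i = j by case=> -[].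
  exists (Block inj0) => /=; first by rewrite card_unit big_nil.
  by move=> phi C B a e [p0 _ _] _ j z _ /=; rewrite !big_nil p0 subrr normr0.
have [b' cb' hb'] := cat (blk i) b; exists b'; first by rewrite big_cons cb' cb.
move=> phi C B a e aaphi h; rewrite !big_cons.
have := hb' _ _ _ _ _ _ _ aaphi (h i) (hb _ _ _ _ _ aaphi h).
by rewrite addrAC.
Qed.

Lemma block_weighted : exists q, forall (I : finType) (blk : I -> block)
    (lam : I -> R), (forall i, 0 <= lam i) -> (forall i, 0 < #|bidx (blk i)|)%N ->
  forall n : nat, exists b : block,
  [/\ (0 < #|bidx b|)%N,
      n%:R * (\sum_i lam i * ln #|bidx (blk i)|%:R) - \sum_i ln #|bidx (blk i)|%:R
        <= ln #|bidx b|%:R :> R &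
  forall phi (C B : R) (a e : I -> R), 0 <= C -> 0 <= B -> aapot C B phi ->
    (forall i, approx phi (blk i) (a i) (e i)) -> (forall i, 0 <= e i) ->
    approx phi b (n%:R * (\sum_i lam i * a i))
      (n%:R * (\sum_i lam i * (e i + (2 * C + B * q%:R))) + \sum_i `|a i|)].
Proof.
have [q cats] := block_cats; exists q => I blk lam lam0 J0 n.
(* Rounding loses less than one block of each type, whence the error terms without the factor
   [n]. *)
pose p i := Num.truncn (n%:R * lam i).
pose s := flatten [seq nseq (p i) i | i <- enum I].
have sumE (F : I -> R) : \sum_(i <- s) F i = \sum_i (p i)%:R * F i.
  rewrite big_flatten/= big_map big_enum/=; apply: eq_bigr => i _.
  by rewrite big_nseq iter_addr_0 mulr_natl.
have p1 i : (p i)%:R <= n%:R * lam i by rewrite truncn_le mulr_ge0.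
have p2 i : n%:R * lam i <= (p i)%:R + 1.
  by rewrite natr1 ltW// /p truncnS_gt.
have [b cb hb] := cats I blk s.
have lnb : ln #|bidx b|%:R = \sum_(i <- s) ln #|bidx (blk i)|%:R :> R.
  rewrite cb; elim: s {cb hb sumE} => [|i s IH]; first by rewrite !big_nil ln1.
  rewrite !big_cons natrM lnM ?IH// posrE ltr0n// big_seq.
  by elim/big_ind : _ => // a c; rewrite muln_gt0 => -> ->.
exists b; split.
- rewrite cb; elim/big_ind : _ => // a c; rewrite muln_gt0; first by move=> -> ->.
- rewrite lnb sumE mulr_sumr -sumrB; apply: ler_sum => i _.
  have ln0 : 0 <= ln #|bidx (blk i)|%:R :> R by rewrite ln_ge0// ler1n.
  rewrite mulrA lerBlDr -[X in _ + X]mul1r -mulrDl.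
  by apply: ler_wpM2r => //; rewrite p2.
- move=> phi C B a e C0 B0 aaphi h e0 j z hz.
  have := hb _ _ _ _ _ aaphi h j z hz; rewrite !sumE.
  have h1 : `|\sum_i (p i)%:R * a i - n%:R * (\sum_i lam i * a i)| <= \sum_i `|a i|.
    rewrite mulr_sumr -sumrB (le_trans (ler_norm_sum _ _ _))//.
    apply: ler_sum => i _; rewrite mulrA -mulrBl normrM ler_piMl//.
    by have := p1 i; have := p2 i; rewrite ler_norml => ? ?; apply/andP; split; lra.
  have h2 : \sum_i (p i)%:R * (e i + (2 * C + B * q%:R)) <=
      n%:R * (\sum_i lam i * (e i + (2 * C + B * q%:R))).
    rewrite mulr_sumr; apply: ler_sum => i _; rewrite mulrA ler_wpM2r//.
    by rewrite addr_ge0// addr_ge0// mulr_ge0.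
  move: h1 h2; set u := \sum_i (p i)%:R * a i; set v := n%:R * _.
  set w := \sum_i (p i)%:R * _; set t := n%:R * _; set r := \sum_i `|a i|.
  rewrite !ler_norml => /andP[? ?] ? /andP[? ?]; apply/andP; split; lra.
Qed.

End Blocks.
Arguments bpt {m A} b _.

(** * Growth of the number of ball words *)

Section Growth.
Variables (R : realType) (m : nat) (A : mixing_mx m).
Implicit Types (x y z : sft A) (phi psi : nat -> sft A -> R).

Definition pref l z : seq 'I_m.+1 := mkseq (letter z) l.

Lemma prefP l y z : pref l y = pref l z <-> agree l y z.
Proof.
split=> [h i il|h].
  by have := congr1 (fun s => nth ord0 s i) h; rewrite !nth_mkseq.
apply: (@eq_from_nth _ ord0); rewrite !size_mkseq// => i il.
by rewrite !nth_mkseq// h.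
Qed.

Lemma cylinder_pref l y z : cylinder A (pref l z) y <-> agree l y z.
Proof. by rewrite /cylinder/= size_mkseq; exact: prefP. Qed.

Lemma take_pref l z : take l.-1 (pref l z) = pref l.-1 z.
Proof. by rewrite -map_take take_iota; congr (map _ (iota _ _)); lia. Qed.

Lemma admissible_pref l z : admissible A (pref l z).
Proof.
apply/(sortedP ord0) => i; rewrite size_mkseq => il.
rewrite !nth_mkseq ?(ltnW il)//.
by apply/eqP; have /set_mem := valP z; exact.
Qed.

(** Since [psi] is nonpositive the exponentials are bounded by 1, and [y] makes the cylinder
    nonempty, so the supremum is genuine. The normalisation at index 0 brings the empty word under
    the same formula. *)
Lemma word_weight_le psi (t : R) w y : (forall x, psi 0%N x = 0) ->
  (forall n x, psi n x <= 0) -> cylinder A w y ->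
  word_weight psi w <= expR t <-> forall x, cylinder A w x -> psi (size w) x <= t.
Proof.
move=> p0 pneg wy.
have -> : word_weight psi w = sup [set expR (psi (size w) x) | x in cylinder A w].
  case: w wy => // _ /=; apply/esym.
  rewrite (_ : [set _ | _ in _] = [set 1]) ?sup1//.
  apply/seteqP; split=> [_ [x _ <-]|_ ->]/=; first by rewrite p0 expR0.
  by exists y => //; rewrite p0 expR0.
split=> [h x wx|h].
  rewrite -ler_expR; apply: le_trans h; apply: ub_le_sup; last by exists x.
  by exists 1 => _ [z _ <-]; rewrite -expR0 ler_expR.
apply: ge_sup; first by exists (expR (psi (size w) y)), y.
by move=> _ [x wx <-]; rewrite ler_expR h.
Qed.

Section Negative.
Variables (psi : nat -> sft A -> R) (kappa : R).
Hypotheses (psi0 : forall x, psi 0%N x = 0) (kappa0 : 0 < kappa).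
Hypothesis psiS : forall n x, psi n.+1 x <= psi n x - kappa.

Lemma psi_decr n k x : psi (n + k)%N x <= psi n x - kappa * k%:R.
Proof.
elim: k => [|k IH]; first by rewrite addn0 mulr0 subr0.
rewrite addnS -natr1 mulrDr mulr1; have := psiS (n + k) x; lra.
Qed.

Lemma psi_le0 n x : psi n x <= 0.
Proof.
have := psi_decr 0 n x; rewrite add0n psi0 sub0r => /le_trans; apply.
by rewrite oppr_le0 mulr_ge0// ltW.
Qed.

Lemma ball_wordsP N w y : cylinder A w y ->
  ball_words psi N w <->
  [/\ forall x, cylinder A w x -> psi (size w) x <= - N%:R &
      exists2 x, agree (size w).-1 x y & - N%:R < psi (size w).-1 x].
Proof.
move=> wy; have wE : w = pref (size w) y by [].
have hadm : admissible A w by rewrite wE admissible_pref.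
have cw l : cylinder A (pref l y) y by apply/cylinder_pref.
have tE : take (size w).-1 w = pref (size w).-1 y by rewrite {2}wE take_pref.
rewrite /ball_words/= tE.
have h1 := word_weight_le (- N%:R) psi0 psi_le0 wy.
have h2 := word_weight_le (- N%:R) psi0 psi_le0 (cw (size w).-1).
split=> [[_ /h1 ? h3]|[/h1 ? [x yx px]]].
  split=> //; apply: contrapT => h4; move: h3; rewrite ltNge => /negP; apply.
  apply/h2 => x /cylinder_pref yx; rewrite size_mkseq leNgt; apply/negP => ?.
  by apply: h4; exists x.
split=> //; rewrite ltNge; apply/negP => /h2/(_ x).
rewrite size_mkseq leNgt px => h3; suff : false by [].
by apply: h3; exact/cylinder_pref.
Qed.

(** The decay by [kappa] per letter makes the first condition of [ball_wordsP] true eventually. At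
    the least such [k], its failure at [k.-1] is the second condition. *)
Lemma hitting N z : (0 < N)%N -> exists2 k, (0 < k)%N & ball_words psi N (pref k z).
Proof.
move=> N0.
have ex : exists k, `[< forall y, agree k y z -> psi k y <= - N%:R >].
  exists (Num.truncn (N%:R / kappa)).+1; apply/asboolP => y _.
  have := psi_decr 0 (Num.truncn (N%:R / kappa)).+1 y.
  rewrite add0n psi0 sub0r => /le_trans; apply.
  rewrite lerN2 mulrC -ler_pdivrMr// ltW//; exact: truncnS_gt.
case: (ex_minnP ex) => k /asboolP hk kmin.
have k0 : (0 < k)%N.
  rewrite lt0n; apply/negP => /eqP k0; move: (hk z); rewrite k0 psi0 => /(_ (agree_refl _)).
  by rewrite oppr_ge0 leNgt ltr0n N0.
exists k => //; apply/(@ball_wordsP N _ z); first exact/cylinder_pref.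
rewrite size_mkseq; split=> [x /cylinder_pref|]; first exact: hk.
apply: contrapT => h; suff : (k <= k.-1)%N by lia.
apply: kmin; apply/asboolP => y hy; rewrite leNgt; apply/negP => ?.
by apply: h; exists y.
Qed.

End Negative.
End Growth.

(** * Concatenations within a prescribed budget of [- psi] *)

Section BlockGrowth.
Variables (R : realType) (m d : nat) (A : mixing_mx m).
Variables (Phi : 'I_d.+1 -> nat -> sft A -> R) (psi : nat -> sft A -> R).
Variables (C B kappa : R).
Hypotheses (C0 : 0 <= C) (B1 : 1 <= B) (kappa0 : 0 < kappa).
Hypothesis Phi_aa : forall j, aapot C B (Phi j).
Hypothesis psi_aa : aapot C B psi.
Hypothesis psiS : forall n x, psi n.+1 x <= psi n x - kappa.

Let psi0 x : psi 0%N x = 0. Proof. by have [+ _ _] := psi_aa; apply. Qed.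

(* Every point of [b] is followed until its prefix enters [ball_words psi N]. *)
Lemma block_extend (b : block A) (N : nat) (mu : R) : (0 < N)%N ->
  (forall i, - psi (blen b) (bpt b i) <= N%:R) ->
  (forall i y, agree (blen b) y (bpt b i) -> mu <= - psi (blen b) y) ->
  exists2 k : bidx b -> nat,
    injective (fun i => pref (k i) (bpt b i)) &
    forall i, [/\ (blen b <= k i)%N, ball_words psi N (pref (k i) (bpt b i)),
      (0 < k i)%N & (k i - blen b)%N%:R <= (N%:R - mu) / kappa + 1].
Proof.
move=> N0 hpsi hmu.
have /choice[k hk] : forall i, exists k, (0 < k)%N /\ ball_words psi N (pref k (bpt b i)).
  by move=> i; have [k ? ?] := hitting psi0 kappa0 psiS (bpt b i) N0; exists k.
have kP i : [/\ (blen b <= k i)%N, ball_words psi N (pref (k i) (bpt b i)),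
      (0 < k i)%N & (k i - blen b)%N%:R <= (N%:R - mu) / kappa + 1].
  have [k0 bk] := hk i.
  have muN : mu <= N%:R by apply: le_trans (hpsi i); exact: hmu.
  have cz : cylinder A (pref (k i) (bpt b i)) (bpt b i) by apply/cylinder_pref.
  have /(ball_wordsP psi0 kappa0 psiS N cz) := bk.
  rewrite size_mkseq => -[/(_ _ cz) kN [y ya yN]].
  (* Otherwise [psi] would already be at most [- N] before the end of the block and would then
     decrease strictly, against [hpsi]. *)
  have bk' : (blen b <= k i)%N.
    rewrite leqNgt; apply/negP => kb.
    have := psi_decr psiS (k i) (blen b - k i) (bpt b i).
    rewrite subnKC ?(ltnW kb)// => h.
    have h2 := hpsi i.
    have : 0 < kappa * (blen b - k i)%N%:R by rewrite mulr_gt0// ltr0n subn_gt0.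
    by lra.
  split=> //; have [kb|kb] := leqP (k i) (blen b).
    rewrite (_ : k i - blen b = 0)%N; last by lia.
    by rewrite addr_ge0// divr_ge0 ?subr_ge0// ltW.
  (* One letter before the stop, [y] still has [psi] above [- N], so the letters added so far spend
     less than [N - mu], at [kappa] each. The last letter accounts for the [+ 1]. *)
  have yb : agree (blen b) y (bpt b i) by apply: agree_leq ya; lia.
  have := psi_decr psiS (blen b) ((k i).-1 - blen b) y.
  rewrite subnKC; last by lia.
  have -> : (k i - blen b = ((k i).-1 - blen b) + 1)%N by lia.
  rewrite natrD lerD2r ler_pdivlMr// mulrC.
  by have := hmu i y yb; lra.
exists k => // i i' h.
have kk : k i = k i' by have := congr1 size h; rewrite !size_mkseq.
move: h; rewrite -kk => /prefP h; apply: binj; apply: agree_leq h.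
by have [] := kP i.
Qed.

(** Per round of weights [lam], [L] is the length, [S] the logarithm of the count, [E] the error on
    every potential and [D] the budget allowed for [- psi], so about [N / D] rounds fit into [N].
    The gap hypothesis adds, per round, the error [E] on [Phi], the error [E] on the length times
    [alpha], and at most [2 * E / kappa] letters of extension, each priced at [B] plus the size of
    [alpha]. The right side is [eps] times the guaranteed length. *)
Lemma block_growth : exists q : nat, forall (I : finType) (blk : I -> block A)
    (lam s e : I -> R) (a : I -> 'rV[R]_d.+1) (alpha : 'rV[R]_d.+1) (eps v : R),
  (forall i, 0 <= lam i) -> (forall i, (0 < #|bidx (blk i)|)%N) ->
  (forall i, 0 <= e i) ->
  (forall i, approx psi (blk i) (s i) (e i)) ->
  (forall i j, approx (Phi j) (blk i) (a i 0 j) (e i)) ->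
  let E := \sum_i lam i * (e i + (2 * C + B * q%:R)) in
  let D := E - \sum_i lam i * s i in
  let L := \sum_i lam i * (blen (blk i))%:R in
  let S := \sum_i lam i * ln #|bidx (blk i)|%:R in
  0 < eps -> 0 < D ->
  (forall j, `|\sum_i lam i * a i 0 j - L * alpha 0 j| +
     E * (1 + `|alpha 0 j| + (B + `|alpha 0 j|) * (2 / kappa)) < eps * (L - E)) ->
  v * D < S ->
  \forall N \near \oo, exists (J : finType) (f : J -> seq 'I_m.+1),
    [/\ injective f, (forall i, level_words Phi psi alpha N eps (f i)),
        (0 < #|J|)%N & v * N%:R <= ln #|J|%:R].
Proof.
have [q weighted] := block_weighted R A; exists q.
move=> I blk lam s e a alpha eps v lam0 J0 e0 hs ha E D L S eps0 D0 gap vS.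
have B0 : 0 <= B by apply: le_trans B1.
have E0 : 0 <= E.
  by apply: sumr_ge0 => i _; rewrite mulr_ge0// addr_ge0// addr_ge0// mulr_ge0.
pose cl := \sum_i `|(blen (blk i))%:R : R|.
pose cs := \sum_i `|s i|.
pose ca j := \sum_i `|a i 0 j|.
pose cS := \sum_i ln #|bidx (blk i)|%:R : R.
have cl0 : 0 <= cl by exact: sumr_ge0.
have cs0 : 0 <= cs by exact: sumr_ge0.
have ca0 j : 0 <= ca j by exact: sumr_ge0.
(* Reserving [cs] for the rounding of the weights keeps [- psi] of the concatenation below [N]. *)
pose P (N : nat) := Num.truncn ((N%:R - cs) / D).
have Plarge (M : R) : \forall N \near \oo, M <= (P N)%:R.
  exists (Num.truncn ((`|M| + 1) * D + cs)).+1 => // N /= hN.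
  have h1 : (`|M| + 1) * D + cs <= N%:R.
    apply: le_trans (_ : _ <= (Num.truncn ((`|M| + 1) * D + cs)).+1%:R) _.
      by rewrite ltW// truncnS_gt.
    by rewrite ler_nat.
  have h2 : `|M| + 1 <= (N%:R - cs) / D by rewrite ler_pdivlMr// lerBrDr.
  have h3 := truncnS_gt ((N%:R - cs) / D); rewrite -/(P N) -natr1 in h3.
  by have := ler_norm M; lra.
have PN (N : nat) : cs <= N%:R -> (P N)%:R * D + cs <= N%:R < ((P N)%:R + 1) * D + cs.
  move=> csN; have h1 : (P N)%:R <= (N%:R - cs) / D.
    by rewrite truncn_le; apply: divr_ge0; [rewrite subr_ge0|exact: ltW].
  have h2 : (N%:R - cs) / D < (P N)%:R + 1 by rewrite natr1 truncnS_gt.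
  move: h1 h2; rewrite ler_pdivlMr// ltr_pdivrMr// => h1 h2.
  by apply/andP; split; lra.
pose G j := eps * (L - E) - (`|\sum_i lam i * a i 0 j - L * alpha 0 j| +
     E * (1 + `|alpha 0 j| + (B + `|alpha 0 j|) * (2 / kappa))).
have G0 j : 0 < G j by rewrite subr_gt0.
(* The part of the extension that does not grow with [N]: an unfinished round, the rounding on both
   sides, and one last letter. *)
pose r0 := (D + 2 * cs) / kappa + 1.
(* All errors that do not grow with [N]; they are beaten by the gain [G j] of each round. *)
pose c1 j := eps * cl + C + B * r0 + ca j + cl * `|alpha 0 j| + r0 * `|alpha 0 j|.
near=> N.
have N0 : (0 < N)%N by near: N; exists 1%N.
have csN : cs <= N%:R.
  have : (Num.truncn cs).+1%:R <= N%:R :> R.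
    by rewrite ler_nat; near: N; exists (Num.truncn cs).+1.
  by apply: le_trans; rewrite ltW// truncnS_gt.
have Pc j : (c1 j + 1) / G j <= (P N)%:R.
  by move: j; near: N; apply: filter_forall => j; exact: Plarge.
have Pv : (cS + `|v| * (D + cs)) / (S - v * D) <= (P N)%:R by near: N; exact: Plarge.
have /andP[PN1 PN2] := PN _ csN.
have [b [b0 lnb hb]] := weighted I blk lam lam0 J0 (P N).
have bs := hb _ _ _ _ _ C0 B0 psi_aa hs e0.
have len_approx i : approx (fun n _ => n%:R) (blk i) (blen (blk i))%:R (e i).
  by move=> z y _; rewrite subrr normr0.
have bl := hb _ _ _ _ _ C0 B0 (aapot_leq C0 B1 (aapot_length R A)) len_approx e0.
have ba j := hb _ _ _ _ _ C0 B0 (Phi_aa j) (fun i => ha i j) e0.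
rewrite -/E -/L -/S -/cs -/cl -/cS in bs bl ba lnb.
have psiub i y : agree (blen b) y (bpt b i) ->
    - ((P N)%:R * (\sum_i lam i * s i) + ((P N)%:R * E + cs)) <= - psi (blen b) y.
  by move=> /bs; rewrite ler_norml => /andP[_]; lra.
have psilb i : - psi (blen b) (bpt b i) <= N%:R.
  apply: le_trans PN1; have := bs i _ (@agree_refl m A _ _).
  by rewrite ler_norml /D => /andP[+ _]; lra.
have [k kinj kP] := block_extend N0 psilb psiub.
exists (bidx b), (fun i => pref (k i) (bpt b i)); split => //; last first.
  apply: le_trans lnb; move: Pv; rewrite ler_pdivrMr ?subr_gt0// => Pv.
  (* [v] may be negative, so [N] is compared with [P N * D] on both sides. *)
  have vN : v * N%:R <= v * ((P N)%:R * D) + `|v| * (D + cs).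
    rewrite -lerBlDl -mulrBr (le_trans (ler_norm _))// normrM ler_wpM2l//.
    by rewrite ler_norml; apply/andP; split; lra.
  by rewrite -/cS; lra.
move=> i; have [bk ballk k0 rk] := kP i; split=> //.
exists (bpt b i); first exact/cylinder_pref.
rewrite size_mkseq; apply: mx_norm_ltP => j; rewrite !mxE.
have kR0 : 0 < (k i)%:R :> R by rewrite ltr0n.
have -> : (k i)%:R^-1 * Phi j (k i) (bpt b i) - alpha 0 j =
    (Phi j (k i) (bpt b i) - (k i)%:R * alpha 0 j) / (k i)%:R.
  by field; rewrite gt_eqF.
rewrite normrM normfV [`|_%:R|]ger0_norm// ltr_pdivrMr//.
set z := bpt b i; set r := (k i - blen b)%N.
have kE : (k i)%:R = (blen b)%:R + r%:R :> R by rewrite -natrD subnKC.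
have [_ aa bd] := Phi_aa j.
have h1 := aa (blen b) r z; rewrite subnKC// in h1.
have h2 := bd r (sh (blen b) z).
have h3 := ba j i _ (@agree_refl m A _ _).
have h4 := bl i _ (@agree_refl m A _ _).
have hr : r%:R <= (P N)%:R * E * (2 / kappa) + r0.
  apply: le_trans rk _.
  have -> : (P N)%:R * E * (2 / kappa) + r0 =
      (2 * ((P N)%:R * E) + (D + 2 * cs)) / kappa + 1 by rewrite /r0; ring.
  rewrite lerD2r ler_pM2r ?invr_gt0//.
  by move: PN2; rewrite /D; lra.
have hB : B * r%:R <= B * ((P N)%:R * E * (2 / kappa) + r0) by rewrite ler_wpM2l.
have hal : `|alpha 0 j| * r%:R <= `|alpha 0 j| * ((P N)%:R * E * (2 / kappa) + r0).
  by rewrite ler_wpM2l.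
have {}h4 : `|alpha 0 j| * `|(blen b)%:R - (P N)%:R * L| <=
    `|alpha 0 j| * ((P N)%:R * E + cl) by rewrite ler_wpM2l.
have := h4; rewrite -normrM mulrC => {}h4.
have h5 : (P N)%:R * `|\sum_i lam i * a i 0 j - L * alpha 0 j| =
   `|(P N)%:R * (\sum_i lam i * a i 0 j) - (P N)%:R * L * alpha 0 j|.
  by rewrite -mulrA -mulrBr normrM ger0_norm.
have h7 : eps * ((P N)%:R * L - ((P N)%:R * E + cl)) <= eps * (k i)%:R.
  rewrite ler_pM2l// kE lerBlDr -lerBlDl; apply: le_trans (_ : `|(P N)%:R * L - (blen b)%:R| <= _).
    by rewrite (le_trans _ (ler_norm _))// lerD2l lerN2 lerDl.
  by rewrite distrC; exact: (bl i _ (@agree_refl m A _ _)).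
have h8 := Pc j; rewrite ler_pdivrMr// in h8.
apply: le_lt_trans (_ : _ <= C + B * r%:R + ((P N)%:R * E + ca j) +
   (P N)%:R * `|\sum_i lam i * a i 0 j - L * alpha 0 j| + `|alpha 0 j| * ((P N)%:R * E + cl)
   + `|alpha 0 j| * r%:R) _.
  have h9 : `|r%:R * alpha 0 j| = `|alpha 0 j| * r%:R by rewrite normrM ger0_norm// mulrC.
  (* The errors in turn: the cut after [b], the value on the extension, the approximation of [Phi]
     on [b], the mismatch of the weighted averages, the length of [b], the length of the
     extension. *)
  have -> : Phi j (k i) z - (k i)%:R * alpha 0 j =
      (Phi j (k i) z - (Phi j (blen b) z + Phi j r (sh (blen b) z))) +
      Phi j r (sh (blen b) z) + (Phi j (blen b) z - (P N)%:R * (\sum_i lam i * a i 0 j)) +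
      ((P N)%:R * (\sum_i lam i * a i 0 j) - (P N)%:R * L * alpha 0 j) -
      ((blen b)%:R - (P N)%:R * L) * alpha 0 j - r%:R * alpha 0 j.
    by rewrite kE; ring.
  rewrite -h9 h5.
  rewrite (le_trans (ler_normB _ _))// lerD// (le_trans (ler_normB _ _))// lerD//.
  rewrite (le_trans (ler_normD _ _))// lerD// (le_trans (ler_normD _ _))// lerD//.
  by rewrite (le_trans (ler_normD _ _))// lerD.
apply: lt_le_trans h7; rewrite /G /c1 in h8.
move: hB hal h8; clear.
move: (P N)%:R `|alpha 0 j| `|_ - _| (2 / kappa) r%:R (ca j) => p al g w r' c.
by move=> *; lra.
Unshelve. all: by end_near.
Qed.

End BlockGrowth.

(** * Cardinals and lower limits *)

Section Counting.
Variables (R : realType) (T : choiceType).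

Lemma counting_ge (J : finType) (f : J -> T) (X : set T) :
  injective f -> (forall i, X (f i)) -> ((#|J|%:R)%:E <= @counting T R X)%E.
Proof.
move=> finj fX; rewrite /counting; case: asboolP => [Xfin|_]; last exact: leey.
rewrite lee_fin ler_nat cardE -(size_map f); apply: uniq_leq_size.
  by rewrite map_inj_uniq ?enum_uniq.
by move=> _ /mapP[i _ ->]; rewrite in_fset_set// inE.
Qed.

Lemma counting_fin (X : set T) : finite_set X -> exists (J : finType) (f : J -> T),
  [/\ injective f, (forall i, X (f i)) & @counting T R X = (#|J|%:R)%:E].
Proof.
move=> Xfin; pose t := in_tuple (finmap.enum_fset (fset_set X)).
exists 'I_(size (finmap.enum_fset (fset_set X))), (tnth t); split.
- by apply/tuple_uniqP; exact: finmap.fset_uniq.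
- by move=> i; have := mem_tnth i t; rewrite /= in_fset_set// inE.
- by rewrite /counting; case: asboolP => // _; rewrite card_ord.
Qed.

End Counting.

Section LimInf.
Variable R : realType.
Implicit Types u : (\bar R)^nat.
Local Open Scope ereal_scope.

Lemma limn_einfE u : limn_einf u = ereal_sup (range (einfs u)).
Proof. by rewrite limn_einf_lim; apply/cvg_lim => //; exact: cvg_einfs_sup. Qed.

Lemma limn_einf_ge u (v : \bar R) : (\forall n \near \oo, v <= u n) -> v <= limn_einf u.
Proof.
move=> [N _ h]; rewrite limn_einfE.
apply: le_trans (ereal_sup_ubound _); last by exists N.
by apply: le_ereal_inf_tmp => _ [k /= Nk <-]; exact: h.
Qed.

Lemma limn_einf_le u (v : \bar R) : (forall n, u n <= v) -> limn_einf u <= v.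
Proof.
move=> h; rewrite limn_einfE; apply: ge_ereal_sup => _ [n _ <-].
by apply: le_trans (h n); apply: ereal_inf_lbound; exists n => /=.
Qed.

Lemma lt_limn_einf u (v : \bar R) : v < limn_einf u -> \forall n \near \oo, v < u n.
Proof.
rewrite limn_einfE => /ereal_sup_gt[_ [n _ <-] vn]; exists n => // k /= nk.
by apply: lt_le_trans vn _; apply: ereal_inf_lbound; exists k.
Qed.

Lemma limn_einf_mono u v : (forall n, u n <= v n) -> limn_einf u <= limn_einf v.
Proof.
move=> uv; rewrite !limn_einfE; apply: ge_ereal_sup => _ [n _ <-].
apply: le_trans (ereal_sup_ubound _); last by exists n.
apply: le_ereal_inf_tmp => _ [k /= nk <-]; apply: le_trans (uv k).
by apply: ereal_inf_lbound; exists k.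
Qed.

End LimInf.

(** * Growth rates and first bounds on Lambda *)

Section GrowthRate.
Variables (R : realType) (m d : nat) (A : mixing_mx m).
Variables (Phi : 'I_d.+1 -> nat -> sft A -> R) (psi : nat -> sft A -> R).

Lemma level_words_mono alpha beta n (e e' : R) : e + `|beta - alpha| <= e' ->
  level_words Phi psi alpha n e `<=` level_words Phi psi beta n e'.
Proof.
move=> ee' w [bw [x wx h]]; split=> //; exists x => //; apply: lt_le_trans ee'.
by rewrite (le_lt_trans (ler_distD alpha _ _))// ltr_leD// distrC.
Qed.

End GrowthRate.

Section LambdaBounds.
Variables (R : realType) (m d : nat) (A : mixing_mx m).
Variables (Phi : 'I_d.+1 -> nat -> sft A -> R) (psi : nat -> sft A -> R).
Variables (C B kappa : R).
Hypotheses (B1 : 1 <= B) (kappa0 : 0 < kappa).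
Hypothesis psi_aa : aapot C B psi.
Hypothesis psiS : forall n x, psi n.+1 x <= psi n x - kappa.

Let psi0 x : psi 0%N x = 0. Proof. by have [+ _ _] := psi_aa; apply. Qed.

(** The decay [kappa] prevents long words from staying above [- N], and the growth bound [B]
    prevents short ones from reaching it. *)
Lemma ball_words_size N w y : cylinder A w y -> ball_words psi N w ->
  (size w).-1%:R <= N%:R / kappa /\ N%:R <= B * (size w)%:R.
Proof.
move=> wy /(ball_wordsP psi0 kappa0 psiS N wy) [/(_ _ wy) h1 [x _ h2]]; split.
  rewrite ler_pdivlMr// mulrC; have := psi_decr psiS 0 (size w).-1 x.
  by rewrite add0n psi0; lra.
have [_ _ /(_ (size w) y)] := psi_aa.
by rewrite ler_norml => /andP[h _]; lra.
Qed.

Let maxlen (N : nat) := (Num.truncn (N%:R / kappa)).+1.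

Lemma level_words_size alpha N eps w : level_words Phi psi alpha N eps w ->
  (size w <= maxlen N)%N.
Proof.
move=> [bw [y wy _]]; have [h _] := ball_words_size wy bw.
rewrite /maxlen; have : ((size w).-1 <= Num.truncn (N%:R / kappa))%N.
  by rewrite truncn_ge_nat// divr_ge0// ltW.
lia.
Qed.

Let logm := ln (m.+2)%:R : R.

(** The base [m.+2], one more than the number of letters, absorbs the words shorter than [k]. *)
Lemma card_bseq_le (k : nat) : (#|{: k.-bseq 'I_m.+1}| <= m.+2 ^ k)%N.
Proof.
rewrite card_bseq card_ord; elim: k => [|k IH]; first by rewrite big_ord1.
rewrite big_ord_recr/= (leq_trans (leq_add IH (leqnn _)))// [X in (_ <= X)%N]expnS.
rewrite mulSn leq_add2l expnS leq_mul2l/=.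
by case: k {IH} => // k; rewrite leq_exp2r.
Qed.

Lemma level_words_finite alpha N eps : finite_set (level_words Phi psi alpha N eps).
Proof.
apply: (@sub_finite_set _ _ [set (val b : seq _) | b in [set: (maxlen N).-bseq 'I_m.+1]]).
  by move=> w /level_words_size h; exists (Bseq h).
by apply: finite_image; exact: finite_finset.
Qed.

Lemma level_words_card alpha N eps (J : finType) (f : J -> seq 'I_m.+1) :
  injective f -> (forall i, level_words Phi psi alpha N eps (f i)) ->
  (#|J| <= m.+2 ^ maxlen N)%N.
Proof.
move=> finj fl; apply: leq_trans (card_bseq_le _).
apply: (@leq_card _ _ (fun i => Bseq (level_words_size (fl i)))) => i j.
by move=> /(congr1 val) /= /finj.
Qed.

Let bound := (kappa^-1 + 1) * logm.

Lemma growth_rate_le alpha eps : (growth_rate Phi psi alpha eps <= bound%:E)%E.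
Proof.
have lm0 : 0 <= logm by rewrite ln_ge0// ler1n.
have b0 : 0 <= bound by rewrite mulr_ge0// addr_ge0// invr_ge0 ltW.
(* At index 0 the factor is the inverse of 0, that is 0, and the term vanishes. *)
apply: limn_einf_le => -[|N]; first by rewrite invr0 mul0e lee_fin.
have [J [f [finj fl ->]]] := counting_fin R (level_words_finite alpha N.+1 eps).
have [J0|J0] := posnP #|J|.
  by rewrite J0/= lexx mulrNy gtr0_sg ?invr_gt0// mul1e leNye.
rewrite lne_EFin ?ltr0n// -EFinM lee_fin mulrC ler_pdivrMr//.
have := level_words_card finj fl; rewrite -(@ler_nat R) => h.
have {h} : ln #|J|%:R <= ln ((m.+2 ^ maxlen N.+1)%:R) :> R.
  by rewrite ler_ln// posrE ltr0n// expn_gt0.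
move/le_trans; apply; rewrite natrX lnXn// -[leLHS]mulr_natl -/logm /bound.
rewrite [leRHS]mulrAC ler_wpM2r//.
rewrite /maxlen -natr1 mulrDl mul1r lerD ?ler1n// [leRHS]mulrC truncn_le.
by rewrite divr_ge0// ltW.
Qed.

Lemma growth_rate_ge alpha eps (v : R) :
  (\forall N \near \oo, exists (J : finType) (f : J -> seq 'I_m.+1),
    [/\ injective f, (forall i, level_words Phi psi alpha N eps (f i)),
        (0 < #|J|)%N & v * N%:R <= ln #|J|%:R]) ->
  (v%:E <= growth_rate Phi psi alpha eps)%E.
Proof.
move=> h; apply: limn_einf_ge; near=> N.
have N0 : (0 < N)%N by near: N; exists 1%N.
have [J [f [finj fl J0 vJ]]] : exists (J : finType) (f : J -> seq 'I_m.+1),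
    [/\ injective f, (forall i, level_words Phi psi alpha N eps (f i)),
        (0 < #|J|)%N & v * N%:R <= ln #|J|%:R] by near: N.
have le1 := counting_ge R finj fl.
apply: (@le_trans _ _ ((N%:R^-1)%:E * lne (#|J|%:R)%:E)%E).
  by rewrite lne_EFin ?ltr0n// -EFinM lee_fin mulrC ler_pdivlMr// ltr0n.
rewrite lee_pmul2l ?lte_fin ?invr_gt0 ?ltr0n//.
rewrite lee_lne// in_itv/= leey andbT ?lee_fin//.
by apply: le_trans le1; rewrite lee_fin.
Unshelve. all: by end_near.
Qed.

Lemma growth_rate_extract alpha eps (v : R) :
  (v%:E < growth_rate Phi psi alpha eps)%E ->
  \forall N \near \oo, exists (J : finType) (f : J -> seq 'I_m.+1),
    [/\ injective f, (forall i, level_words Phi psi alpha N eps (f i)),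
        (0 < #|J|)%N & v * N%:R <= ln #|J|%:R].
Proof.
move=> /lt_limn_einf h; near=> N.
have N0 : (0 < N)%N by near: N; exists 1%N.
have Ninv : 0 < N%:R^-1 :> R by rewrite invr_gt0 ltr0n.
have : (v%:E < (N%:R^-1)%:E * lne (counting (level_words Phi psi alpha N eps)))%E by near: N.
have [J [f [finj fl ->]]] := counting_fin R (level_words_finite alpha N eps).
have [J0|J0] := posnP #|J|.
  by rewrite J0/= lexx mulrNy gtr0_sg// mul1e.
rewrite lne_EFin ?ltr0n// -EFinM lte_fin => vJ; exists J, f; split=> //.
by rewrite -ler_pdivlMr ?ltr0n// mulrC ltW.
Unshelve. all: by end_near.
Qed.

Lemma growth_rate_mono alpha beta (e e' : R) : e + `|beta - alpha| <= e' ->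
  (growth_rate Phi psi alpha e <= growth_rate Phi psi beta e')%E.
Proof.
move=> ee'; apply: limn_einf_mono => -[|N]; first by rewrite invr0 !mul0e.
rewrite lee_pmul2l ?lte_fin ?invr_gt0//.
have [J [f [finj fl ->]]] := counting_fin R (level_words_finite alpha N.+1 e).
have le1 := counting_ge R finj (fun i => level_words_mono ee' (fl i)).
rewrite lee_lne// in_itv/= leey andbT ?lee_fin//.
by apply: le_trans le1; rewrite lee_fin.
Qed.

(** The rate is monotone in the radius, so its limit at 0 from the right is an infimum, and lower
    bounds can be tested at each radius. *)
Lemma Lambda_extE alpha :
  Lambda_ext Phi psi alpha = ereal_inf [set growth_rate Phi psi alpha e | e in `]0, +oo[].
Proof.
apply/cvg_lim => //; apply: (@nondecreasing_at_right_cvge _ _ 0 (BInfty _ false)) => //.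
by move=> e e' _ _ ee'; apply: growth_rate_mono; rewrite subrr normr0 addr0.
Qed.

Lemma Lambda_ext_ge alpha (v : \bar R) :
  (v <= Lambda_ext Phi psi alpha)%E <->
  forall e, 0 < e -> (v <= growth_rate Phi psi alpha e)%E.
Proof.
rewrite Lambda_extE; split=> [h e e0|h].
  apply: le_trans h _; apply: ereal_inf_lbound; exists e => //=.
  by rewrite in_itv/= e0.
by apply: le_ereal_inf_tmp => _ [e /= eI <-]; apply: h; move: eI; rewrite in_itv/= andbT.
Qed.

Lemma Lambda_ext_le alpha e : 0 < e ->
  (Lambda_ext Phi psi alpha <= growth_rate Phi psi alpha e)%E.
Proof. exact: (Lambda_ext_ge _ _).1 (lexx _) e. Qed.

Lemma Lambda_ext_bound alpha : (Lambda_ext Phi psi alpha <= bound%:E)%E.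
Proof. by apply: le_trans (Lambda_ext_le _ ltr01) _; exact: growth_rate_le. Qed.

End LambdaBounds.

(** * Weakly concave functions *)

Section WeaklyConcave.
Variables (R : realType) (d : nat).
Local Notation V := 'rV[R]_d.+1.
Variables (L : set V) (h : V -> R).

(* The reparametrisation of the segment in the definition of weak concavity is
   onto, so every point of it is reached, with a weight comparable to the
   barycentric one. *)
Lemma weakly_concave_point : weakly_concave L h -> exists2 c : R, 0 < c &
  forall x y (th : R), L x -> L y -> 0 <= th <= 1 -> exists t : R,
    [/\ 0 <= t <= 1, t <= c * th &
        (1 - t) * h x + t * h y <= h ((1 - th) *: x + th *: y)].
Proof.
move=> [c c1 hc]; have c0 : 0 < c by apply: lt_le_trans c1.
exists (c * c); first by rewrite mulr_gt0.
move=> x y th Lx Ly /andP[th0 th1].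
have [g1 [g2 [/andP[g1c g1c'] /andP[g2c g2c'] H]]] := hc x y Lx Ly.
have ci0 : 0 < c^-1 by rewrite invr_gt0.
have g10 : 0 < g1 by apply: lt_le_trans g1c.
have g20 : 0 < g2 by apply: lt_le_trans g2c.
(* Weights proportional to [(1 - th) * g2] and [th * g1] become proportional to [1 - th] and [th]
   once multiplied by [g1] and [g2]; [D] normalises them. *)
pose D := (1 - th) * g2 + th * g1.
have Dc : c^-1 <= D.
  have : (1 - th) * c^-1 <= (1 - th) * g2 by rewrite ler_wpM2l// subr_ge0.
  have : th * c^-1 <= th * g1 by rewrite ler_wpM2l.
  by rewrite /D; lra.
have D0 : 0 < D by apply: lt_le_trans Dc.
have h1 : th * g1 <= D by rewrite lerDr mulr_ge0 ?subr_ge0// ltW.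
exists (th * g1 / D); have t01 : 0 <= th * g1 / D <= 1.
  by rewrite divr_ge0 ?mulr_ge0 ?(ltW g10) ?(ltW D0)//= ler_pdivrMr// mul1r.
split=> //.
  have cD : 1 <= c * D by rewrite -(mulfV (lt0r_neq0 c0)) ler_pM2l.
  have a1 : th * g1 <= th * c by rewrite ler_wpM2l.
  have a2 : th * c * 1 <= th * c * (c * D) by rewrite ler_wpM2l// mulr_ge0// ltW.
  by rewrite ler_pdivrMr//; lra.
have := H (1 - th * g1 / D); rewrite subKr => H'.
have tE : 1 - th * g1 / D = (1 - th) * g2 / D.
  by rewrite -[1](mulfV (lt0r_neq0 D0)) -mulrBl /D addrK mulfV ?lt0r_neq0.
have t01' : 0 <= (1 - th) * g2 / D <= 1.
  rewrite divr_ge0 ?mulr_ge0 ?subr_ge0 ?(ltW g20) ?(ltW D0)//= ler_pdivrMr// mul1r.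
  by rewrite /D lerDl mulr_ge0// ltW.
rewrite tE in H' *; move: H' => /(_ t01') /le_trans; apply.
rewrite le_eqVlt; apply/orP; left; apply/eqP.
have D0' := lt0r_neq0 D0; have g10' := lt0r_neq0 g10; have g20' := lt0r_neq0 g20.
have -> : (1 - th) * g2 / D * g1 + th * g1 / D * g2 = g1 * g2 / D by field.
congr (h _); rewrite scalerDr !scalerA; congr (_ *: _ + _ *: _).
  by field; rewrite ?D0' ?g10' ?g20'.
by field; rewrite ?D0' ?g10' ?g20'.
Qed.

(* [th] plays the role of the ratio of [|x - x0|] to the length of an extension
   of the segment from [x0] to [x] inside [L]. *)
Definition extendable (S : set V) (x0 : V) : Prop :=
  exists2 M : R, 0 <= M & exists2 dl : R, 0 < dl &
    forall x, S x -> `|x - x0| < dl -> exists th y,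
      [/\ 0 <= th <= 1, L y, x = (1 - th) *: x0 + th *: y & th <= M * `|x - x0|].

Hypothesis wch : weakly_concave L h.
Hypothesis h0 : forall x, L x -> 0 <= h x.

(** For the lower bound, [x] lies between [x0] and a far point [y]. Dropping the nonnegative term in
    [h y] leaves [(1 - t) * h x0], where [t] is at most a constant times the distance of [x] to
    [x0]. *)
Lemma weakly_concave_continuous (S : set V) :
  (forall x e, L x -> 0 < e -> exists2 dl, 0 < dl &
    forall y, L y -> `|y - x| < dl -> h y < h x + e) ->
  S `<=` L -> (forall x0, S x0 -> extendable S x0) ->
  {within S, continuous h}.
Proof.
move=> usc SL ext; apply/subspace_continuousP => x0 Sx0.
have Lx0 := SL _ Sx0.
have [c c0 hc] := weakly_concave_point wch.
have [M M0 [dl dl0 hM]] := ext _ Sx0.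
apply/cvgrPdist_lt => e e0.
have [dl' dl'0 husc] := usc x0 e Lx0 e0.
(* The summand 1 keeps [K] positive when [h x0 = 0]. *)
pose K := c * M * h x0 + 1.
have K0 : 0 < K by rewrite ltr_wpDl// !mulr_ge0// ?h0// ltW.
have xx0 (r : R) : 0 < r -> \forall z \near within S (nbhs x0), `|z - x0| < r.
  move=> r0; apply: cvg_within; near=> z; rewrite distrC.
  by near: z; apply: cvgr_dist_lt.
near=> x.
have Sx : S x by near: x; exact: withinT.
have xdl : `|x - x0| < dl by near: x; exact: xx0.
have xdl' : `|x - x0| < dl' by near: x; exact: xx0.
have xe : `|x - x0| < e / K by near: x; apply: xx0; rewrite divr_gt0.
have [th [y [th01 Ly xE thM]]] := hM x Sx xdl.
have [t [/andP[t0 t1] tc ht]] := hc x0 y th Lx0 Ly th01.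
rewrite -xE in ht.
have up := husc x (SL _ Sx) xdl'.
rewrite -[ltLHS]/(`|h x0 - h x|) ltr_norml; apply/andP; split; first by lra.

have h1 : t * h x0 <= c * M * h x0 * `|x - x0|.
  by rewrite [leRHS]mulrAC ler_wpM2r ?h0// (le_trans tc)// -mulrA ler_wpM2l// ltW.
have h2 : c * M * h x0 * `|x - x0| <= K * `|x - x0| by rewrite ler_wpM2r// lerDl.
have h3 : K * `|x - x0| < e by rewrite mulrC -ltr_pdivlMr.
have h4 : 0 <= t * h y by rewrite mulr_ge0// h0.
by lra.
Unshelve. all: by end_near.
Qed.

End WeaklyConcave.

(** * Extending segments inside a set *)

Section Extendable.
Variables (R : realType) (d : nat).
Local Notation V := 'rV[R]_d.+1.
Variables (L : set V) (h : V -> R).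

Lemma segment_extendable u v : segment u v `<=` L ->
  forall x0, segment u v x0 -> extendable L (segment u v) x0.
Proof.
move=> uvL _ [s + <-]; rewrite /= in_itv/= => /andP[s0 s1].
have Lu : L u.
  apply: uvL; exists 1; first by rewrite /= in_itv/= ler01 lexx.
  by apply/rowP => j; rewrite !mxE; ring.
have Lv : L v.
  apply: uvL; exists 0; first by rewrite /= in_itv/= ler01 lexx.
  by apply/rowP => j; rewrite !mxE; ring.
set x0 := _ + _.
have Lx0 : L x0 by apply: uvL; exists s => //=; rewrite in_itv/= s0.
(* The segment is extended to the end point [u] or [v] beyond [x]. If [x0] is itself an end point,
   one inverse is 0, but no point lies on that side. *)
exists ((s^-1 + (1 - s)^-1) / `|u - v|); first by rewrite divr_ge0// addr_ge0 ?invr_ge0 ?subr_ge0.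
exists 1 => // _ [s' + <-] _; rewrite /= in_itv/= => /andP[s'0 s'1].
have xE : s' *: u + (1 - s') *: v - x0 = (s' - s) *: (u - v).
  by rewrite /x0; apply/rowP => j; rewrite !mxE; ring.
have [uv|uv] := eqVneq u v.
  exists 0, v; split; rewrite ?lexx ?ler01//.
    by rewrite /x0 uv; apply/rowP => j; rewrite !mxE; ring.
  by rewrite uv subrr normr0 invr0 mulr0 mul0r.
have uv0 : 0 < `|u - v| by rewrite normr_gt0 subr_eq0.
have dn (p a : R) : p / `|u - v| * (a * `|u - v|) = p * a by field; rewrite gt_eqF.
rewrite xE normrZ dn.
have [ss|ss|<-] := ltgtP s s'.
- have s10 : 0 < 1 - s by lra.
  exists ((s' - s) / (1 - s)), u; split=> //.
  + by rewrite divr_ge0 ?ler_pdivrMr//; lra.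
  + by apply/rowP => j; rewrite /x0 !mxE; field; lra.
  + rewrite ger0_norm ?subr_ge0 ?(ltW ss)//.
    by rewrite mulrC ler_wpM2r ?subr_ge0 ?(ltW ss)// lerDr invr_ge0.
- have s10 : 0 < s by lra.
  exists ((s - s') / s), v; split=> //.
  + by rewrite divr_ge0 ?ler_pdivrMr//; lra.
  + by apply/rowP => j; rewrite /x0 !mxE; field; lra.
  + rewrite distrC ger0_norm ?subr_ge0 ?(ltW ss)//.
    by rewrite mulrC ler_wpM2r ?subr_ge0 ?(ltW ss)// lerDl invr_ge0 subr_ge0.
- exists 0, v; split => //; rewrite ?lexx ?ler01 ?subrr ?normr0 ?mul0r ?mulr0//.
  by rewrite /x0; apply/rowP => j; rewrite !mxE; ring.
Qed.

Lemma extendable_radius (S : set V) x0 (rho : R) : 0 < rho -> L x0 ->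
  (forall x, S x -> x != x0 -> L (x0 + (rho / `|x - x0|) *: (x - x0))) ->
  extendable L S x0.
Proof.
move=> rho0 Lx0 H; exists rho^-1; first by rewrite invr_ge0 ltW.
exists rho => // x Sx xrho; have [->|xx0] := eqVneq x x0.
  exists 0, x0; split => //; rewrite ?lexx ?ler01 ?subrr ?normr0 ?mulr0//.
  by apply/rowP => j; rewrite !mxE; ring.
have n0 : 0 < `|x - x0| by rewrite normr_gt0 subr_eq0.
exists (`|x - x0| / rho), (x0 + (rho / `|x - x0|) *: (x - x0)); split.
- by rewrite divr_ge0 ?(ltW rho0)//= ler_pdivrMr// mul1r ltW.
- exact: H.
- apply/rowP => j; rewrite !mxE; move: `|_| n0 => n n0; field.
  by rewrite !gt_eqF.
- by rewrite mulrC.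
Qed.

Lemma rel_interior_extendable (K : set V) : K `<=` L ->
  forall x0, rel_interior K x0 -> extendable L (rel_interior K) x0.
Proof.
move=> KL x0 [Kx0 [e e0 hK]].
have e20 : 0 < e / 2 by rewrite divr_gt0.
apply: (extendable_radius e20 (KL _ Kx0)) => x [Kx _] xx0.
have n0 : 0 < `|x - x0| by rewrite normr_gt0 subr_eq0.
apply: KL; apply: hK; split.
  rewrite -ball_normE/= opprD addNKr normrN normrZ ger0_norm ?divr_ge0 ?(ltW e0) ?(ltW e20)//.
  by rewrite divfK ?gt_eqF//; lra.
set s := (X in X *: _).
(* The extended point is an affine combination of [x0] and [x]; its coefficients may leave the unit
   interval. *)
exists 2%N, (fun i : 'I_2 => if i == 0 then x0 else x),
  (fun i : 'I_2 => if i == 0 then 1 - s else s); split.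
- by move=> i; case: ifP.
- by rewrite !big_ord_recl big_ord0/=; ring.
- rewrite !big_ord_recl big_ord0/=; apply/rowP => j; rewrite !mxE; ring.
Qed.

(** A constraint tight at [x0] cannot increase in the direction of a point [x] of [L], so it holds
    along the whole ray. A slack constraint leaves room proportional to its slack, and there are
    finitely many of them. *)
Lemma polyhedron_extendable : is_polyhedron L ->
  forall x0, L x0 -> extendable L L x0.
Proof.
move=> [k [a [b LE]]] x0 Lx0.
have sl0 i : \sum_j a i 0 j * x0 0 j <= b i by move: Lx0; rewrite LE; apply.
pose sl i : R := b i - \sum_j a i 0 j * x0 0 j.
pose n1 i : R := \sum_j `|a i 0 j| + 1.
have n10 i : 0 < n1 i by rewrite ltr_wpDl// sumr_ge0.
(* The value 1 is taken when every constraint is tight at [x0]. *)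
pose rho : R := \big[Num.min/1]_(i | 0 < sl i) (sl i / n1 i).
have rho0 : 0 < rho by apply: lt_bigmin => [|i sli]; rewrite ?ltr01// divr_gt0.
have hrho i : 0 < sl i -> rho * n1 i <= sl i.
  by move=> sli; rewrite -ler_pdivlMr//; exact: bigmin_le_cond.
apply: (extendable_radius rho0 Lx0) => x Lx xx0.
have n0 : 0 < `|x - x0| by rewrite normr_gt0 subr_eq0.
set w := x - x0.
have Lx' i : \sum_j a i 0 j * x 0 j <= b i by move: Lx; rewrite LE; apply.
have aw i : \sum_j a i 0 j * w 0 j = \sum_j a i 0 j * x 0 j - \sum_j a i 0 j * x0 0 j.
  by rewrite -sumrB; apply: eq_bigr => j _; rewrite !mxE mulrBr.
rewrite LE => i /=.
have -> : \sum_j a i 0 j * (x0 + (rho / `|w|) *: w) 0 j =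
   \sum_j a i 0 j * x0 0 j + rho / `|w| * \sum_j a i 0 j * w 0 j.
  rewrite mulr_sumr -big_split; apply: eq_bigr => j _; rewrite /= 2!mxE.
  by move: (w 0 j) (`|w|) => wj n; ring.
have [sli|] := ltP 0 (sl i).
  rewrite -lerBrDl; apply: le_trans (hrho i sli).
  rewrite -mulrA ler_pM2l// ler_pdivrMl// /n1 mulrDr mulr1.
  apply: (@le_trans _ _ (`|w| * \sum_j `|a i 0 j|)); last by rewrite lerDl.
  rewrite mulr_sumr; apply: ler_sum => j _; apply: le_trans (ler_norm _) _.
  by rewrite normrM mulrC ler_wpM2r//; exact: mx_norm_coord.
move=> sli; have -> : \sum_j a i 0 j * x0 0 j = b i by apply/eqP; rewrite eq_le sl0/= -subr_le0.
rewrite gerDl mulr_ge0_le0 ?divr_ge0 ?(ltW rho0)// aw.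
by move: (Lx' i) sli; rewrite /sl; lra.
Qed.

(** The point at [s] lies between [u] and the point at [t]. Its value is at least a mean of theirs,
    hence at least the smaller one, which is that at [t]. *)
Lemma weakly_concave_nonincreasing u v : weakly_concave L h ->
  (forall t, 0 <= t <= 1 -> L ((1 - t) *: u + t *: v)) ->
  (forall t, 0 <= t <= 1 -> h ((1 - t) *: u + t *: v) <= h u) ->
  nonincreasing_along h u v.
Proof.
move=> /weakly_concave_point[c _ hc] uvL hu s t s0 st t1.
have [t0|t0] := leP t 0.
  by have -> : s = t by lra.
have Lu : L u by have := uvL 0; rewrite subr0 scale1r scale0r addr0; apply; rewrite lexx ler01.
have t01 : 0 <= t <= 1 by rewrite t1 ltW.
have st1 : 0 <= s / t <= 1 by rewrite divr_ge0 ?(ltW t0)//= ler_pdivrMr// mul1r.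
have [p [/andP[p0 p1] _]] := hc u _ (s / t) Lu (uvL t t01) st1.
have -> : (1 - s / t) *: u + (s / t) *: ((1 - t) *: u + t *: v) = (1 - s) *: u + s *: v.
  by apply/rowP => j; rewrite !mxE; field; rewrite gt_eqF.
apply: le_trans; have := hu t t01.
set a := h u; set b := h _ => ba.
have : (1 - p) * b <= (1 - p) * a by rewrite ler_wpM2l// subr_ge0.
by lra.
Qed.

End Extendable.

(** * Weak concavity of Lambda *)

Section LevelBlocks.
Variables (R : realType) (m d : nat) (A : mixing_mx m).
Variables (Phi : 'I_d.+1 -> nat -> sft A -> R) (psi : nat -> sft A -> R).
Variables (C B kappa : R).
Hypotheses (C0 : 0 <= C) (B1 : 1 <= B) (kappa0 : 0 < kappa).
Hypothesis Phi_aa : forall j, aapot C B (Phi j).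
Hypothesis psi_aa : aapot C B psi.
Hypothesis psiS : forall n x, psi n.+1 x <= psi n x - kappa.
Hypothesis psi_var : forall delta, 0 < delta -> exists2 D, 0 <= D &
  forall n x y, agree n x y -> `|psi n x - psi n y| <= delta * n%:R + D.
Hypothesis Phi_var : forall j delta, 0 < delta -> exists2 D, 0 <= D &
  forall n x y, agree n x y -> `|Phi j n x - Phi j n y| <= delta * n%:R + D.

Let psi0 x : psi 0%N x = 0. Proof. by have [+ _ _] := psi_aa; apply. Qed.

Lemma common_var (delta : R) : 0 < delta -> exists D, [/\ 0 <= D,
  forall n x y, agree n x y -> `|psi n x - psi n y| <= delta * n%:R + D &
  forall j n x y, agree n x y -> `|Phi j n x - Phi j n y| <= delta * n%:R + D].
Proof.
move=> delta0; have [D1 D10 h1] := psi_var delta0.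
have /choice[D2 hD2] : forall j, exists D, 0 <= D /\
    forall n x y, agree n x y -> `|Phi j n x - Phi j n y| <= delta * n%:R + D.
  by move=> j; have [D ? ?] := Phi_var j delta0; exists D.
have D20 : 0 <= \sum_j D2 j by apply: sumr_ge0 => j _; have [] := hD2 j.
exists (D1 + \sum_j D2 j); split; first exact: addr_ge0.
  by move=> n x y /h1/le_trans; apply; rewrite lerD2l lerDl.
move=> j n x y; have [_ /[apply]] := hD2 j; move/le_trans; apply.
rewrite lerD2l (bigD1 j)//= addrCA lerDl addr_ge0// sumr_ge0// => i _.
by have [] := hD2 i.
Qed.

(** The left side is the logarithm of the number of possible lengths in [ball_words psi n]; its
    sublinearity makes the pigeonhole free of cost in the rate. *)
Lemma near_ln_le (eta : R) : 0 < eta ->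
  \forall n \near \oo, ln ((Num.truncn (n%:R / kappa)).+2)%:R <= eta * n%:R.
Proof.
move=> eta0; near=> n.
have h1 : 1 / eta <= n%:R by near: n; exact: near_natr.
have h2 : 4 / (eta ^+ 2 * kappa) <= n%:R by near: n; exact: near_natr.
have nk : (Num.truncn (n%:R / kappa))%:R <= n%:R / kappa.
  by rewrite truncn_le divr_ge0// ltW.
rewrite -ler_expR lnK ?posrE ?ltr0n//.
(* Squaring [1 + y <= expR y] gives a quadratic lower bound, which beats the linear number of
   lengths. *)
have -> : eta * n%:R = 2%:R * (eta * n%:R / 2) by lra.
rewrite expRM_natl.
have h3 := expR_ge1Dx (eta * n%:R / 2).
apply: (@le_trans _ _ ((1 + eta * n%:R / 2) ^+ 2)); last first.
  by rewrite lerXn2r// ?nnegrE ?addr_ge0 ?expR_ge0// divr_ge0// mulr_ge0// ltW.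
apply: (@le_trans _ _ (n%:R / kappa + 2)).
  by rewrite -[in leLHS]addn2 natrD lerD2r.
have h4 : 1 <= eta * n%:R by rewrite mulrC -ler_pdivrMr.
have h5 : n%:R / kappa <= (eta * n%:R / 2) ^+ 2.
  rewrite ler_pdivrMr//.
  have : 4 <= n%:R * (eta ^+ 2 * kappa) by rewrite -ler_pdivrMr// mulr_gt0// exprn_gt0.
  move=> /(ler_wpM2l (ler0n R n)); rewrite !expr2; lra.
rewrite [leRHS](_ : _ = 1 + eta * n%:R + (eta * n%:R / 2) ^+ 2); last by rewrite !expr2; field.
lra.
Unshelve. all: by end_near.
Qed.

Lemma pigeonhole (J : finType) (s : J -> nat) (M : nat) :
  (forall i, (s i <= M)%N) -> exists l, (#|J| <= #|[pred i | s i == l]| * M.+1)%N.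
Proof.
move=> sM; apply: contrapT => /forallNP h.
have [J0|J0] := posnP #|J|; first by apply: (h 0%N); rewrite J0.
suff : (#|J| * M.+1 < #|J| * M.+1)%N by rewrite ltnn.
pose c (l : 'I_M.+1) := #|[pred i | s i == l]|.
have cardE : #|J| = (\sum_(l < M.+1) c l)%N.
  rewrite -sum1_card (partition_big (fun i => inord (s i) : 'I_M.+1) predT)//=.
  apply: eq_bigr => l _; rewrite /c -sum1_card; apply: eq_bigl => i.
  by rewrite !inE -val_eqE/= inordK// ltnS.
rewrite {1}cardE big_distrl/=.
have -> : (#|J| * M.+1 = \sum_(l < M.+1) #|J|)%N by rewrite sum_nat_const card_ord mulnC.
have cl (l : 'I_M.+1) : (c l * M.+1 < #|J|)%N.
  by rewrite ltnNge; apply/negP; exact: h.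
rewrite (bigD1 ord0)//= [X in (_ < X)%N](bigD1 ord0)//= -addSn leq_add//.
by apply: leq_sum => l _; exact: ltnW.
Qed.

(** [c] bounds the ratio of length to [n], and its inverse, for the words of [ball_words psi n]. *)
Let c := B + kappa^-1 + 1.

(** Half of the loss [eps] comes from the choice of a rate below [v], the other half from the
    restriction to the most frequent length. *)
Lemma level_block alpha (v eps : R) : 0 < eps ->
  (forall e, 0 < e -> ((v - eps / 2)%:E < growth_rate Phi psi alpha e)%E) ->
  \forall n \near \oo, exists b : block A,
  [/\ (0 < #|bidx b|)%N, c^-1 * n%:R <= (blen b)%:R <= c * n%:R,
      (v - eps) * n%:R <= ln #|bidx b|%:R,
      approx psi b (- n%:R) (eps * n%:R) &
      forall j, approx (Phi j) b ((blen b)%:R * alpha 0 j) (eps * n%:R)].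
Proof.
move=> eps0 hv.
have ki0 : 0 <= kappa^-1 by rewrite invr_ge0 ltW.
have cB : B <= c by rewrite /c; lra.
have B0 : 0 < B by apply: lt_le_trans B1.
have c0 : 0 < c by apply: lt_le_trans cB.
(* Lengths are at most [c * n], so two errors [e * l] take half of [eps * n]; the other half is left
   for the constants. *)
pose e := eps / (4 * c); have e0 : 0 < e by rewrite divr_gt0// mulr_gt0.
have [D [D0 psiD PhiD]] := common_var e0.
near=> n.
have n0 : (0 < n)%N by near: n; exists 1%N.
have nD : (D + C + B) / (eps / 2) <= n%:R by near: n; exact: near_natr.
have nln : ln ((Num.truncn (n%:R / kappa)).+2)%:R <= eps / 2 * n%:R.
  by near: n; apply: near_ln_le; rewrite divr_gt0.
have [J [f [finj fl J0 vJ]]] : exists (J : finType) (f : J -> seq 'I_m.+1),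
    [/\ injective f, (forall i, level_words Phi psi alpha n e (f i)),
        (0 < #|J|)%N & (v - eps / 2) * n%:R <= ln #|J|%:R].
  by near: n; apply: (growth_rate_extract B1 kappa0 psi_aa psiS); exact: hv.
have /choice[x hx] : forall i, exists x, cylinder A (f i) x /\
    `|(size (f i))%:R^-1 *: vec_potential Phi (size (f i)) x - alpha| < e.
  by move=> i; have [_ [x ? ?]] := fl i; exists x.
have [l hl] := pigeonhole (fun i => level_words_size B1 kappa0 psi_aa psiS (fl i)).
pose K := {i | size (f i) == l}.
have cardK : #|{: K}| = #|[pred i | size (f i) == l]| by rewrite card_sig.
have sz (i : K) : size (f (val i)) = l by apply/eqP; exact: (valP i).
have fE (i : K) : f (val i) = pref l (x (val i)).
  by have [h _] := hx (val i); rewrite /cylinder/= sz in h.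
have inj (i j : K) : agree l (x (val i)) (x (val j)) -> i = j.
  by move=> /prefP; rewrite -!fE => /finj /val_inj.
pose b := Block inj; exists b => /=.
have K0 : (0 < #|{: K}|)%N by rewrite cardK; lia.
have [i0 _] : exists i0 : K, true by case/card_gt0P: K0 => i0 _; exists i0.
have xc (i : K) : cylinder A (f (val i)) (x (val i)) by have [] := hx (val i).
have bw (i : K) : ball_words psi n (f (val i)) by have [] := fl (val i).
have [ls1 ls2] := ball_words_size kappa0 psi_aa psiS (xc i0) (bw i0).
rewrite sz in ls1 ls2.
have l0 : (0 < l)%N.
  by rewrite lt0n; apply/eqP => l0; move: ls2; rewrite l0 mulr0 leNgt ltr0n n0.
have l1E : l%:R = l.-1%:R + 1 :> R by rewrite natr1 prednK.
have n1 : 1 <= n%:R :> R by rewrite ler1n.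
have Bl : 0 <= B * l%:R by rewrite mulr_ge0// ltW.
have lc : l%:R <= c * n%:R.
  have : 0 <= B * n%:R by rewrite mulr_ge0// ltW.
  by rewrite l1E /c 2!mulrDl mul1r [kappa^-1 * _]mulrC; lra.
have err : e * l%:R + e * l%:R + (D + C + B) <= eps * n%:R.
  have h1 : e * l%:R <= e * (c * n%:R) by rewrite ler_pM2l.
  have h2 : e * (c * n%:R) = eps / 4 * n%:R by rewrite /e; field; rewrite gt_eqF.
  by move: nD; rewrite ler_pdivrMr ?divr_gt0//; lra.
have el0 : 0 <= e * l%:R by rewrite mulr_ge0// ltW.
split=> //.
- apply/andP; split=> //; rewrite mulrC ler_pdivrMr// mulrC.
  by apply: le_trans ls2 _; rewrite ler_wpM2r.
- have h1 : ln #|J|%:R <= ln #|{: K}|%:R + ln ((Num.truncn (n%:R / kappa)).+2)%:R :> R.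
    rewrite -lnM ?posrE ?ltr0n// ler_ln ?posrE ?mulr_gt0 ?ltr0n// -natrM ler_nat.
    by rewrite cardK; exact: hl.
  by lra.
(* The ball condition gives [psi <= - n] at [z]. Conversely [psi] exceeds [- n] at a point [y] one
   letter earlier; passing from [y] to [z] costs the variation, and the last letter costs
   [C + B]. *)
- move=> i z /= zi; rewrite opprK.
  have /(ball_wordsP psi0 kappa0 psiS n (xc i)) [hle [y hy]] := bw i.
  rewrite sz in hle hy *; move=> py.
  have zc : cylinder A (f (val i)) z by rewrite fE; exact/cylinder_pref.
  have h1 := hle _ zc.
  have [_ aa bd] := psi_aa.
  have h2 := aa l.-1 1%N z; rewrite addn1 prednK// in h2.
  have h3 := bd 1%N (sh l.-1 z); rewrite mulr1 in h3.
  have h4 := psiD l.-1 z y (agree_trans (agree_leq (leq_pred l) zi) (agree_sym hy)).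
  have h5 : e * l.-1%:R <= e * l%:R by rewrite ler_pM2l// ler_nat leq_pred.
  move: h2 h3 h4; rewrite !ler_norml => /andP[? ?] /andP[? ?] /andP[? ?].
  by apply/andP; split; lra.
- move=> j i z /= zi.
  have h1 := PhiD j l z (x (val i)) zi.
  have [_] := hx (val i); rewrite sz => /(le_lt_trans (mx_norm_coord _ j)); rewrite !mxE.
  have -> : l%:R^-1 * Phi j l (x (val i)) - alpha 0 j =
    (Phi j l (x (val i)) - l%:R * alpha 0 j) / l%:R by field; rewrite pnatr_eq0 -lt0n.
  rewrite normrM normfV [`|l%:R|]ger0_norm// ltr_pdivrMr ?ltr0n// => h2.
  apply: le_trans err; apply: le_trans (ler_distD (Phi j l (x (val i))) _ _) _.
  by move: h1 h2 C0 B0; clear; lra.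
Unshelve. all: by end_near.
Qed.

End LevelBlocks.

(** * Mixing blocks of two levels *)

Section LambdaConcave.
Variables (R : realType) (m d : nat) (A : mixing_mx m).
Variables (Phi : 'I_d.+1 -> nat -> sft A -> R) (psi : nat -> sft A -> R).
Variables (C B kappa : R).
Hypotheses (C0 : 0 <= C) (B1 : 1 <= B) (kappa0 : 0 < kappa).
Hypothesis Phi_aa : forall j, aapot C B (Phi j).
Hypothesis psi_aa : aapot C B psi.
Hypothesis psiS : forall n x, psi n.+1 x <= psi n x - kappa.
Hypothesis psi_var : forall delta, 0 < delta -> exists2 D, 0 <= D &
  forall n x y, agree n x y -> `|psi n x - psi n y| <= delta * n%:R + D.
Hypothesis Phi_var : forall j delta, 0 < delta -> exists2 D, 0 <= D &
  forall n x y, agree n x y -> `|Phi j n x - Phi j n y| <= delta * n%:R + D.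

Let c := B + kappa^-1 + 1.

Lemma le_growth_rate alpha e (v : R) :
  (forall rho, 0 < rho -> ((v - rho)%:E <= growth_rate Phi psi alpha e)%E) ->
  (v%:E <= growth_rate Phi psi alpha e)%E.
Proof.
move=> h; apply/lee_addgt0Pr => rho rho0.
by rewrite -leeBlDr// -EFinB; exact: h.
Qed.

Definition level_approx (alpha : 'rV[R]_d.+1) (v eps : R) (n : nat) (b : block A) :=
  [/\ (0 < #|bidx b|)%N, c^-1 * n%:R <= (blen b)%:R <= c * n%:R,
      (v - eps) * n%:R <= ln #|bidx b|%:R,
      approx psi b (- n%:R) (eps * n%:R) &
      forall j, approx (Phi j) b ((blen b)%:R * alpha 0 j) (eps * n%:R)].

Lemma two_block_growth : exists q : nat, forall (alpha beta x : 'rV[R]_d.+1)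
  (va vb g1 g2 t eps rho e : R) (n : nat) (b1 b2 : block A),
  0 < eps -> 0 <= t <= 1 -> 0 < e -> (0 < n)%N -> 2 * C + B * q%:R <= e * n%:R ->
  0 <= va -> 0 <= vb -> 0 < rho ->
  level_approx alpha va e n b1 -> level_approx beta vb e n b2 ->
  `|(blen b1)%:R / n%:R - g1| <= e -> `|(blen b2)%:R / n%:R - g2| <= e ->
  (t * g1) *: alpha + ((1 - t) * g2) *: beta = (t * g1 + (1 - t) * g2) *: x ->
  (forall j, e * (`|alpha 0 j - x 0 j| + `|beta 0 j - x 0 j| +
     2 * (1 + `|x 0 j| + (B + `|x 0 j|) * (2 / kappa)) + 2 * eps) < eps / c) ->
  e * (2 * (t * va + (1 - t) * vb) + 1) < rho ->
  ((t * va + (1 - t) * vb - rho)%:E <= growth_rate Phi psi x eps)%E.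
Proof.
have [q H] := block_growth C0 B1 kappa0 Phi_aa psi_aa psiS; exists q.
move=> alpha beta x va vb g1 g2 t eps rho e n b1 b2 eps0 /andP[t0 t1] e0 n0 Kn va0 vb0 rho0.
move=> [J1 /andP[l1c l1c'] S1 p1 P1] [J2 /andP[l2c l2c'] S2 p2 P2] hg1 hg2 xE he hrho.
have B0 : 0 < B by apply: lt_le_trans B1.
have ki0 : 0 <= kappa^-1 by rewrite invr_ge0 ltW.
have c0 : 0 < c by rewrite /c -addrA ltr_wpDr// addr_ge0.
have t1' : 0 <= 1 - t by rewrite subr_ge0.
have nR : 0 < n%:R :> R by rewrite ltr0n.
apply: growth_rate_ge.
pose sel T (u w : T) (i : bool) := if i then u else w.
pose V := t * va + (1 - t) * vb.
have V0 : 0 <= V by rewrite addr_ge0// mulr_ge0.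
pose K := 2 * C + B * q%:R.
have K0 : 0 <= K by rewrite addr_ge0// mulr_ge0// ltW.
have := H bool (sel _ b1 b2) (sel _ t (1 - t)) (sel _ (- n%:R) (- n%:R)) (fun=> e * n%:R)
  (sel _ ((blen b1)%:R *: alpha) ((blen b2)%:R *: beta)) x eps (V - rho).
have en0 : 0 < e * n%:R by rewrite mulr_gt0.
rewrite !big_bool /sel/= -/K.
have E1 : t * (e * n%:R + K) + (1 - t) * (e * n%:R + K) = e * n%:R + K by ring.
have E2 : t * - n%:R + (1 - t) * - n%:R = - n%:R :> R by ring.
rewrite E1 E2 opprK; apply=> //.
- by case.
- by case.
- by move=> _; exact: ltW.
- by case.
- by case=> j; rewrite mxE.
- by rewrite ltr_wpDl// addr_ge0// ltW.
- move=> j; rewrite big_bool !mxE.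
  set L := t * _ + (1 - t) * (blen b2)%:R.
  have Lc : c^-1 * n%:R <= L.
    have h1 : t * (c^-1 * n%:R) <= t * (blen b1)%:R by rewrite ler_wpM2l.
    have h2 : (1 - t) * (c^-1 * n%:R) <= (1 - t) * (blen b2)%:R by rewrite ler_wpM2l.
    by rewrite /L; lra.
  have := normr_ge0 (x 0 j); set y := `|x 0 j| => y0; set Q := 1 + y + _.
  have Q0 : 0 <= Q.
    have h1 : 0 <= (B + y) * (2 / kappa).
      by apply: mulr_ge0; [apply: addr_ge0 y0; exact: ltW|rewrite divr_ge0// ltW].
    by rewrite /Q; apply: addr_ge0 => //; apply: addr_ge0; first exact: ler01.
  (* [x] is the exact barycentre for the limit ratios [g1] and [g2]; after recentring at [x] only
     the deviations of the true ratios remain, each at most [e]. *)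
  have xj : t * g1 * (alpha 0 j - x 0 j) + (1 - t) * g2 * (beta 0 j - x 0 j) = 0.
    have /rowP/(_ j) := xE; rewrite !mxE => h.
    by rewrite -[RHS](subrr ((t * g1 + (1 - t) * g2) * x 0 j)) -{1}h; ring.
  have h3 : `|t * ((blen b1)%:R * alpha 0 j) + (1 - t) * ((blen b2)%:R * beta 0 j) - L * x 0 j|
     <= n%:R * e * (`|alpha 0 j - x 0 j| + `|beta 0 j - x 0 j|).
    have -> : t * ((blen b1)%:R * alpha 0 j) + (1 - t) * ((blen b2)%:R * beta 0 j) - L * x 0 j =
       n%:R * ((t * ((blen b1)%:R / n%:R - g1)) * (alpha 0 j - x 0 j) +
               ((1 - t) * ((blen b2)%:R / n%:R - g2)) * (beta 0 j - x 0 j)).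
      apply: etrans (_ : _ = n%:R * ((t * ((blen b1)%:R / n%:R)) * (alpha 0 j - x 0 j) +
               ((1 - t) * ((blen b2)%:R / n%:R)) * (beta 0 j - x 0 j) -
               (t * g1 * (alpha 0 j - x 0 j) + (1 - t) * g2 * (beta 0 j - x 0 j)))) _.
        by rewrite xj subr0 /L; field; rewrite gt_eqF.
      by ring.
    rewrite normrM ger0_norm// -[leRHS]mulrA ler_wpM2l// [leRHS]mulrDr (le_trans (ler_normD _ _))//.
    rewrite !normrM; apply: lerD; apply: ler_wpM2r => //.
      by rewrite (ger0_norm t0) (le_trans _ hg1)// ler_piMl.
    by rewrite (ger0_norm t1') (le_trans _ hg2)// ler_piMl//; lra.
  have h4 : (e * n%:R + K) * Q <= 2 * (e * n%:R) * Q by rewrite ler_wpM2r//; rewrite /K; lra.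
  have := he j; rewrite -/y -/Q -(ltr_pM2r nR) => h5.
  have h6 : eps * (c^-1 * n%:R) <= eps * L by rewrite ler_pM2l.
  have h7 : eps * (e * n%:R + K) <= eps * (2 * (e * n%:R)) by rewrite ler_pM2l// /K; lra.
  by move: h3 h4 h5 h6 h7; clear; lra.
- have h1 : t * ((va - e) * n%:R) <= t * ln #|bidx b1|%:R by rewrite ler_wpM2l.
  have h2 : (1 - t) * ((vb - e) * n%:R) <= (1 - t) * ln #|bidx b2|%:R by rewrite ler_wpM2l.
  apply: lt_le_trans (lerD h1 h2).
  have h3 : V * (e * n%:R + K) <= V * (2 * (e * n%:R)) by rewrite ler_wpM2l// /K; lra.
  have h4 : 0 <= rho * (e * n%:R + K) by rewrite mulr_ge0 ?(ltW rho0)// addr_ge0// ltW.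
  move: hrho; rewrite -/V -(ltr_pM2r nR).
  by move: h3 h4; rewrite /V; lra.
Qed.

End LambdaConcave.

(** * Upper semicontinuity and weak concavity *)

Section LambdaSemicontinuous.
Variables (R : realType) (m d : nat) (A : mixing_mx m).
Variables (Phi : 'I_d.+1 -> nat -> sft A -> R) (psi : nat -> sft A -> R).
Variables (C B kappa : R).
Hypotheses (C0 : 0 <= C) (B1 : 1 <= B) (kappa0 : 0 < kappa).
Hypothesis Phi_aa : forall j, aapot C B (Phi j).
Hypothesis psi_aa : aapot C B psi.
Hypothesis psiS : forall n x, psi n.+1 x <= psi n x - kappa.
Hypothesis psi_var : forall delta, 0 < delta -> exists2 D, 0 <= D &
  forall n x y, agree n x y -> `|psi n x - psi n y| <= delta * n%:R + D.
Hypothesis Phi_var : forall j delta, 0 < delta -> exists2 D, 0 <= D &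
  forall n x y, agree n x y -> `|Phi j n x - Phi j n y| <= delta * n%:R + D.

Let c := B + kappa^-1 + 1.

(** On this set [Lambda_ext] is finite, being bounded above, so [fine] is faithful. It contains the
    rotation vectors by [Phi_star_level]. *)
Let D0 : set 'rV[R]_d.+1 := [set alpha | (0 <= Lambda_ext Phi psi alpha)%E].

Lemma Lambda_extK alpha : D0 alpha ->
  Lambda_ext Phi psi alpha = (Lambda Phi psi alpha)%:E.
Proof.
move=> a0; rewrite fineK// ge0_fin_numE//.
exact: le_lt_trans (Lambda_ext_bound Phi B1 kappa0 psi_aa psiS alpha) (ltry _).
Qed.

Lemma Lambda_ge0 alpha : D0 alpha -> 0 <= Lambda Phi psi alpha.
Proof. by move=> a0; rewrite -lee_fin -Lambda_extK. Qed.

Lemma Lambda_usc x e : D0 x -> 0 < e -> exists2 dl, 0 < dl &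
  forall y, D0 y -> `|y - x| < dl -> Lambda Phi psi y < Lambda Phi psi x + e.
Proof.
move=> x0 e0.
have [r [r0 hr]] : exists r, 0 < r /\
    (growth_rate Phi psi x r < (Lambda Phi psi x + e)%:E)%E.
  apply: contrapT => /forallNP h.
  have : ((Lambda Phi psi x + e)%:E <= Lambda_ext Phi psi x)%E.
    apply/(Lambda_ext_ge Phi B1 kappa0 psi_aa psiS) => r r0; rewrite leNgt.
    by apply/negP => hr; apply: (h r).
  by rewrite Lambda_extK// lee_fin; lra.
have r20 : 0 < r / 2 by rewrite divr_gt0.
(* The ball of radius [r / 2] around [y] lies in the ball of radius [r] around [x]. *)
exists (r / 2) => // y y0 yx; rewrite -lte_fin -Lambda_extK//; apply: le_lt_trans hr.
apply: le_trans (Lambda_ext_le Phi B1 kappa0 psi_aa psiS y r20) _.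
by apply: (growth_rate_mono Phi B1 kappa0 psi_aa psiS); rewrite distrC; lra.
Qed.

(** Both length ratios must be close to their cluster values at the same index, hence compactness of
    the square. *)
Lemma pair_cluster (u : nat -> R * R) (a b : R) :
  (forall n, a <= (u n).1 <= b) -> (forall n, a <= (u n).2 <= b) ->
  exists g : R * R, [/\ a <= g.1 <= b, a <= g.2 <= b &
    forall e k, 0 < e -> exists n, [/\ (k <= n)%N, `|(u n).1 - g.1| < e &
      `|(u n).2 - g.2| < e]].
Proof.
move=> u1 u2.
have cK := compact_setX (@segment_compact R a b) (@segment_compact R a b).
have [|g [[g1 g2] clg]] := cK (u @ \oo) _.
  by exists 0%N => // n _; split => /=; rewrite in_itv/= ?u1 ?u2.
exists g; split; [by move: g1; rewrite /= in_itv|by move: g2; rewrite /= in_itv|].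
move=> e k e0.
have nb : nbhs g (ball g.1 e `*` ball g.2 e).
  by exists (ball g.1 e, ball g.2 e) => //=; split; exact: nbhsx_ballx.
have Fk : (u @ \oo) (u @` [set n | (k <= n)%N]) by exists k => // n kn; exists n.
have [_ [[n kn <-] [h1 h2]]] := clg _ _ Fk nb.
exists n; split=> //.
  by move: h1; rewrite -ball_normE/= distrC.
by move: h2; rewrite -ball_normE/= distrC.
Qed.

Lemma level_approx_mono alpha (v e e' : R) n (b : block A) : e <= e' ->
  level_approx Phi psi B kappa alpha v e n b ->
  level_approx Phi psi B kappa alpha v e' n b.
Proof.
move=> ee' [b0 bl h p P].
have een : e * n%:R <= e' * n%:R by rewrite ler_wpM2r.
split=> //.
- by apply: le_trans h; rewrite ler_wpM2r// lerD2l lerN2.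
- by move=> i z iz; exact: le_trans (p i z iz) een.
- by move=> j i z iz; exact: le_trans (P j i z iz) een.
Qed.

(** The blocks are chosen for all precisions [ek k] and the cluster values [g1], [g2] extracted
    before [t] is introduced, so that one pair serves the whole segment. *)
Lemma Lambda_weakly_concave : weakly_concave D0 (Lambda Phi psi).
Proof.
have B0 : 0 < B by apply: lt_le_trans B1.
have ki0 : 0 <= kappa^-1 by rewrite invr_ge0 ltW.
have c1 : 1 <= c by rewrite /c -addrA -[leLHS]addr0 lerD// addr_ge0.
have c0 : 0 < c by apply: lt_le_trans c1.
exists c => // alpha beta a0 b0.
have [q growth2] := two_block_growth C0 B1 kappa0 Phi_aa psi_aa psiS.
have [h hE] : exists h, h = Lambda Phi psi by exists (Lambda Phi psi).
rewrite -hE.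
have hK gamma : D0 gamma -> Lambda_ext Phi psi gamma = (h gamma)%:E.
  by rewrite hE; exact: Lambda_extK.
have h0 gamma : D0 gamma -> 0 <= h gamma by rewrite hE; exact: Lambda_ge0.
pose ek (k : nat) : R := k.+1%:R^-1.
have ek0 k : 0 < ek k by rewrite invr_gt0.
have lev gamma k : D0 gamma -> \forall n \near \oo, exists b : block A,
    level_approx Phi psi B kappa gamma (h gamma) (ek k) n b.
  move=> g0; have := level_block C0 B1 kappa0 psi_aa psiS psi_var Phi_var
    (alpha := gamma) (v := h gamma) (ek0 k).
  apply => r r0; apply: lt_le_trans (Lambda_ext_le Phi B1 kappa0 psi_aa psiS gamma r0).
  by rewrite hK// lte_fin ltrBlDr ltrDl divr_gt0.
have /choice[p hp] : forall k, exists p : nat * (block A * block A),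
    [/\ (0 < p.1)%N, 2 * C + B * q%:R <= ek k * p.1%:R,
        level_approx Phi psi B kappa alpha (h alpha) (ek k) p.1 p.2.1 &
        level_approx Phi psi B kappa beta (h beta) (ek k) p.1 p.2.2].
  move=> k; have [N1 _ h1] := near_natr ((2 * C + B * q%:R) / ek k).
  have [N2 _ h2] := lev alpha k a0; have [N3 _ h3] := lev beta k b0.
  pose n := (N1 + N2 + N3).+1.
  have Kn : (2 * C + B * q%:R) / ek k <= n%:R.
    by apply: h1; rewrite /= /n -addnA leqW// leq_addr.
  have [b1 hb1] : exists b, level_approx Phi psi B kappa alpha (h alpha) (ek k) n b.
    by apply: h2; rewrite /= /n addnAC leqW// leq_addl.
  have [b2 hb2] : exists b, level_approx Phi psi B kappa beta (h beta) (ek k) n b.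
    by apply: h3; rewrite /= /n leqW// leq_addl.
  have n0 : (0 < n)%N by [].
  by exists (n, (b1, b2)); split=> //; rewrite [leRHS]mulrC -ler_pdivrMr.
pose u k := ((blen (p k).2.1)%:R / (p k).1%:R : R, (blen (p k).2.2)%:R / (p k).1%:R : R).
have pn k : 0 < (p k).1%:R :> R by rewrite ltr0n; have [] := hp k.
have u1 k : c^-1 <= (u k).1 <= c.
  have [_ _ [_ + _ _ _] _] := hp k; rewrite /= => /andP[? ?].
  by rewrite ler_pdivlMr// ler_pdivrMr//; apply/andP.
have u2 k : c^-1 <= (u k).2 <= c.
  have [_ _ _ [_ + _ _ _]] := hp k; rewrite /= => /andP[? ?].
  by rewrite ler_pdivlMr// ler_pdivrMr//; apply/andP.
have [[g1 g2] /= [g1c g2c clu]] := pair_cluster u1 u2.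
exists g1, g2; split=> // t /[dup] t01 /andP[t0 t1].
have ci0 : 0 < c^-1 by rewrite invr_gt0.
have g10 : 0 < g1 by apply: lt_le_trans ci0 _; case/andP: g1c.
have g20 : 0 < g2 by apply: lt_le_trans ci0 _; case/andP: g2c.
set x := (_ + _)^-1 *: _.
have G0 : 0 < t * g1 + (1 - t) * g2.
  have [->|t0'] := eqVneq t 0; first by rewrite mul0r add0r subr0 mul1r.
  by rewrite ltr_wpDr ?mulr_ge0 ?subr_ge0 ?(ltW g20)// mulr_gt0// lt0r t0'.
have xE : (t * g1) *: alpha + ((1 - t) * g2) *: beta = (t * g1 + (1 - t) * g2) *: x.
  by rewrite /x scalerA mulfV ?gt_eqF// scale1r.
have ha := h0 _ a0; have hb := h0 _ b0.
have V0 : 0 <= t * h alpha + (1 - t) * h beta by rewrite addr_ge0// mulr_ge0// subr_ge0.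
(* This bound also puts [x] in [D0], where [h x] is the true value of [Lambda_ext]. *)
suff Vx : ((t * h alpha + (1 - t) * h beta)%:E <= Lambda_ext Phi psi x)%E.
  have x0 : D0 x by apply: le_trans Vx; rewrite lee_fin.
  by rewrite -lee_fin -hK.
apply/(Lambda_ext_ge Phi B1 kappa0 psi_aa psiS) => eps eps0.
apply: le_growth_rate => rho rho0.
pose M j := `|alpha 0 j - x 0 j| + `|beta 0 j - x 0 j| +
     2 * (1 + `|x 0 j| + (B + `|x 0 j|) * (2 / kappa)) + 2 * eps.
have ek_small (r : R) : 0 < r -> \forall k \near \oo, ek k < r.
  move=> r0; near=> k; rewrite invf_plt ?posrE//.
  have : r^-1 <= k%:R by near: k; exact: near_natr.
  by move/le_lt_trans; apply; rewrite ltr_nat.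
have M0 j : 0 < M j.
  have h1 : 0 <= (B + `|x 0 j|) * (2 / kappa).
    by apply: mulr_ge0; [apply: addr_ge0 (normr_ge0 _); exact: ltW|rewrite divr_ge0// ltW].
  have := normr_ge0 (alpha 0 j - x 0 j); have := normr_ge0 (beta 0 j - x 0 j).
  by have := normr_ge0 (x 0 j); rewrite /M; lra.
have [k0 _ hk0] : \forall k \near \oo, (forall j, ek k * M j < eps / c) /\
    ek k * (2 * (t * h alpha + (1 - t) * h beta) + 1) < rho.
  near=> k; split.
    move=> j; rewrite -ltr_pdivlMr//; move: j; near: k; apply: filter_forall => j.
    by apply: ek_small; rewrite !divr_gt0.
  rewrite -ltr_pdivlMr; last by rewrite ltr_wpDl// mulr_ge0.
  by near: k; apply: ek_small; rewrite divr_gt0// ltr_wpDl// mulr_ge0.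
(* [k0] fixes the precision; the later index [k] has ratios that close to [g1] and [g2], and blocks
   at least as precise. *)
have [k [k0k hg1 hg2]] := clu (ek k0) k0 (ek0 k0).
have [n0 Kn la lb] := hp k.
have ekk : ek k <= ek k0 by rewrite /ek lef_pV2 ?posrE// ler_nat.
have [hk1 hk2] := hk0 k0 (leqnn k0).
have Kn0 : 2 * C + B * q%:R <= ek k0 * (p k).1%:R.
  by apply: le_trans Kn _; rewrite ler_wpM2r.
have la0 := level_approx_mono ekk la; have lb0 := level_approx_mono ekk lb.
exact: (growth2 _ _ _ _ _ g1 g2 _ _ _ _ _ _ _ eps0 t01 (ek0 k0) n0 Kn0 ha hb rho0 la0 lb0
  (ltW hg1) (ltW hg2) xE hk1 hk2).
Unshelve. all: by end_near.
Qed.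

End LambdaSemicontinuous.

(** * Rotation vectors of invariant measures *)

(** Comparing [a (n * p)] with [p * a n] and with [n * a p] shows that every quotient
    [(a n - C) / n] lies below every [(a p + C) / p]; any separating number is the rate. *)
Lemma quasi_additive_rate (R : realType) (C : R) (a : nat -> R) : 0 <= C ->
  a 0%N = 0 -> (forall n p, `|a (n + p)%N - (a n + a p)| <= C) ->
  exists l, forall n, `|a n - n%:R * l| <= C.
Proof.
move=> C0 a0 aD.
have aM n p : `|a (n * p)%N - p%:R * a n| <= C * p%:R.
  elim: p => [|p IH]; first by rewrite muln0 a0 mul0r subrr normr0 mulr0.
  have := aD n (n * p)%N; move: IH; rewrite mulnS -natr1 mulrDr mulrDl !mul1r mulr1.
  by rewrite !ler_norml => /andP[? ?] /andP[? ?]; apply/andP; split; lra.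
have sep n p : p%:R * (a n - C) <= n%:R * (a p + C).
  have := aM n p; have := aM p n; rewrite mulnC !ler_norml !mulrDr mulrN.
  by move=> /andP[? ?] /andP[? ?]; lra.
pose S := [set (a n - C) / n%:R | n in [set n | (0 < n)%N]].
have Sub p : (0 < p)%N -> ubound S ((a p + C) / p%:R).
  move=> p0 _ [n /= n0 <-]; rewrite ler_pdivrMr ?ltr0n// mulrAC ler_pdivlMr ?ltr0n//.
  by rewrite mulrC [leRHS]mulrC.
exists (sup S) => -[|n]; first by rewrite a0 mul0r subrr normr0.
rewrite ler_norml; apply/andP; split.
  have : sup S <= (a n.+1 + C) / n.+1%:R.
    by apply: ge_sup; [exists ((a 1%N - C) / 1%:R), 1%N|exact: Sub].
  by rewrite ler_pdivlMr ?ltr0n// mulrC; lra.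
have : (a n.+1 - C) / n.+1%:R <= sup S.
  by apply: ub_le_sup; [exists ((a 1%N + C) / 1%:R); exact: Sub|exists n.+1].
by rewrite ler_pdivrMr ?ltr0n// mulrC; lra.
Qed.

Section Integrals.
Variables (R : realType) (m : nat) (A : mixing_mx m).
Variable mu : probability (borel_sft A) R.
Implicit Types (g : sft A -> R).

Local Notation Ig g := (\int[mu]_(x in [set: borel_sft A]) g x).
Local Notation integ g := (mu.-integrable [set: borel_sft A] (EFin \o (g : borel_sft A -> R))).

Lemma open_borel (U : set (sft A)) : open U -> measurable (U : set (borel_sft A)).
Proof. by move=> oU; exact: sub_sigma_algebra. Qed.

Lemma continuous_measurable g : continuous g ->
  measurable_fun [set: borel_sft A] (g : borel_sft A -> R).
Proof.
move=> cg; apply: (measurability _ (RGenOInfty.measurableE R)).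
move=> _ [_ [a ->] <-]; rewrite setTI; apply: open_borel.
by move/continuousP: cg; apply; exact: interval_open.
Qed.

Lemma continuous_integrable g : continuous g -> integ g.
Proof.
move=> cg; apply: measurable_bounded_integrable; first exact: measurableT.
- by apply: le_lt_trans (probability_le1 _ _) _; rewrite ?ltry.
- exact: continuous_measurable.
have [B hB] := continuous_bounded cg.
exists B; split; first exact: num_real.
by move=> M BM x _; apply: le_trans (hB x) _; exact: ltW.
Qed.

Lemma integral_dist_le g1 g2 (c : R) : integ g1 -> integ g2 ->
  (forall x, `|g1 x - g2 x| <= c) -> `|Ig g1 - Ig g2| <= c.
Proof.
move=> i1 i2 h; have ic : integ (fun=> c).
  apply: measurable_bounded_integrable => //.
    by apply: le_lt_trans (probability_le1 _ _) _; rewrite ?ltry.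
  exists `|c|; split; first exact: num_real.
  by move=> M cM x _; exact: ltW.
have ib : integ (fun x => g1 x - g2 x).
  have := integrableB measurableT i1 i2.
  by apply: eq_integrable => // x _; rewrite /= EFinB.
rewrite -RintegralB// (le_trans (le_normr_Rintegral measurableT ib))//.
rewrite (le_trans (le_Rintegral measurableT _ ic _))//.
  by have := integrable_norm ib; apply: eq_integrable => // x _.
rewrite Rintegral_cst// (_ : fine _ = 1) ?mulr1//.
by have := probability_setT mu; move=> /= ->.
Qed.

Lemma shift_continuous : continuous (@Defs.shift m A).
Proof.
move=> x U; rewrite nbhs_simpl/= => /nbhs_sftP[r hr]; apply/nbhs_sftP.
by exists r.+1 => y yx; apply: hr => i ir; exact: yx.
Qed.

Lemma sh_continuous n : continuous (fun x : sft A => sh n x).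
Proof.
elim: n => [|n IH] x; first exact: cvg_id.
by apply: (continuous_comp (IH x)); exact: shift_continuous.
Qed.

Lemma shift_measurable :
  measurable_fun [set: borel_sft A] (@Defs.shift m A : borel_sft A -> borel_sft A).
Proof.
have := @measurability _ _ (borel_sft A) (borel_sft A) setT (@Defs.shift m A)
  (@open (sft A)) erefl.
apply => _ [U oU <-].
rewrite setTI; apply: open_borel.
by move/continuousP: shift_continuous; exact.
Qed.

Lemma invariant_integral g : Defs.invariant mu -> continuous g ->
  Ig (fun x => g (@Defs.shift m A x)) = Ig g.
Proof.
move=> inv cg; rewrite /Rintegral; congr fine.
have cgs : continuous (fun x : sft A => g (Defs.shift x)).
  by move=> x; apply: continuous_comp; [exact: shift_continuous|exact: cg].
have mg : measurable_fun [set: borel_sft A] (EFin \o (g : borel_sft A -> R)).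
  by apply/measurable_EFinP; exact: continuous_measurable.
have ig : mu.-integrable (@Defs.shift m A @^-1` setT)
    ((EFin \o (g : borel_sft A -> R)) \o (@Defs.shift m A : borel_sft A -> borel_sft A)).
  by rewrite preimage_setT; exact: continuous_integrable cgs.
have := @integral_pushforward _ _ (borel_sft A) (borel_sft A) R _
  shift_measurable mu setT _ mg ig measurableT.
rewrite preimage_setT => <-.
apply: eq_measure_integral; first exact: shift_measurable.
by move=> mT U mU _; exact: inv.
Qed.

Lemma invariant_integral_iter g n : Defs.invariant mu -> continuous g ->
  Ig (fun x => g (sh n x)) = Ig g.
Proof.
move=> inv cg; elim: n => // n IH; rewrite -[RHS]IH.
rewrite -(@invariant_integral (fun x => g (sh n x)))//.
  by apply: eq_Rintegral => x _; rewrite -iterSr.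
by move=> x; apply: continuous_comp; [exact: sh_continuous|exact: cg].
Qed.

End Integrals.

Section RotationVector.
Variables (R : realType) (m d : nat) (A : mixing_mx m).
Variable mu : probability (borel_sft A) R.
Hypothesis mu_inv : Defs.invariant mu.

Local Notation Ig g := (\int[mu]_(x in [set: borel_sft A]) g x).
Local Notation integ g := (mu.-integrable [set: borel_sft A] (EFin \o (g : borel_sft A -> R))).

Lemma norm0_continuous (phi : nat -> sft A -> R) :
  (forall n, (0 < n)%N -> continuous (phi n)) -> forall n, continuous (norm0 phi n).
Proof.
move=> cphi [|n]; last by exact (cphi n.+1 isT).
exact (@cst_continuous (sft A) R 0).
Qed.

(** By invariance the integrals are quasi-additive. The error [C], uniform in [n], allows a single
    large length to be used later. *)
Lemma Phi_star_rate (Phi : 'I_d.+1 -> nat -> sft A -> R) (C B : R) : 0 <= C ->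
  (forall j n, (0 < n)%N -> continuous (Phi j n)) ->
  (forall j, aapot C B (norm0 (Phi j))) ->
  forall j n, `|Ig (norm0 (Phi j) n) - n%:R * Phi_star Phi mu 0 j| <= C.
Proof.
move=> C0 cPhi aaPhi.
have c0 j := norm0_continuous (cPhi j).
have i0 j n : integ (norm0 (Phi j) n) by exact: continuous_integrable.
have /choice[l hl] : forall j, exists l, forall n, `|Ig (norm0 (Phi j) n) - n%:R * l| <= C.
  move=> j; apply: quasi_additive_rate => //.
    by rewrite Rintegral_cst// mul0r.
  move=> n p; have [_ aa _] := aaPhi j.
  rewrite -(invariant_integral_iter n mu_inv (c0 j p)).
  have cs : continuous (fun x : sft A => norm0 (Phi j) p (sh n x)).
    by move=> x; apply: continuous_comp; [exact: sh_continuous|exact: c0].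
  rewrite -RintegralD//; last exact: continuous_integrable.
  apply: integral_dist_le; [exact: i0| |by move=> x; exact: aa].
  have := integrableD measurableT (i0 j n) (continuous_integrable mu cs).
  by apply: eq_integrable => // x _; rewrite /= EFinD.
suff -> : Phi_star Phi mu = \row_j l j by move=> j n; rewrite mxE.
apply/cvg_lim; first exact: norm_hausdorff.
apply/cvgrPdist_lt => e e0; near=> n.
have n0 : (0 < n)%N by near: n; exists 1%N.
have nC : (C + 1) / e <= n%:R by near: n; exact: near_natr.
have nR : 0 < n%:R :> R by rewrite ltr0n.
apply: mx_norm_ltP => j; rewrite !mxE.
have -> : Ig (fun x => Phi j n x / n%:R) = Ig (norm0 (Phi j) n) / n%:R.
  rewrite -RintegralZr//; apply: eq_Rintegral => x _.
  by case: (n) n0.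
have -> : l j - Ig (norm0 (Phi j) n) / n%:R = - ((Ig (norm0 (Phi j) n) - n%:R * l j) / n%:R).
  by field; rewrite gt_eqF.
rewrite normrN normrM normfV (ger0_norm (ltW nR)) ltr_pdivrMr//.
apply: le_lt_trans (hl j n) _.
by move: nC; rewrite ler_pdivrMr//; lra.
Unshelve. all: by end_near.
Qed.

Lemma cylinder_open (w : seq 'I_m.+1) : open (cylinder A w).
Proof.
rewrite openE => y wy; apply/nbhs_sftP; exists (size w) => z zy.
by rewrite -wy; apply/cylinder_pref.
Qed.

(** A word with empty cylinder receives the default point, but its mass is 0. *)
Let xw (w : seq 'I_m.+1) : sft A := xget point (cylinder A w).
Let mass (w : seq 'I_m.+1) : R := fine (mu (cylinder A w)).

Lemma mass_ge0 w : 0 <= mass w.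
Proof. exact: fine_ge0. Qed.

Lemma integral_sum (I : Type) (s : seq I) (f : I -> sft A -> R) :
  (forall i, integ (f i)) -> integ (fun x => \sum_(i <- s) f i x) /\
  Ig (fun x => \sum_(i <- s) f i x) = \sum_(i <- s) Ig (f i).
Proof.
move=> fi; elim: s => [|i s [IH1 IH2]].
  split; last first.
    rewrite big_nil -[RHS](mul0r (fine (mu setT))) -Rintegral_cst//.
    by apply: eq_Rintegral => x _; rewrite big_nil.
  apply: eq_integrable (continuous_integrable mu (@cst_continuous (sft A) R 0)) => // x _.
  by rewrite /= big_nil.
split.
  have := integrableD measurableT (fi i) IH1.
  by apply: eq_integrable => // x _; rewrite /= big_cons EFinD.
rewrite big_cons -IH2 -RintegralD//; apply: eq_Rintegral => x _.
by rewrite big_cons.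
Qed.

(** The sum is the integral of the step function equal to the value of [g] at one chosen point of
    each cylinder. *)
Lemma cylinder_average (g : sft A -> R) k (c : R) : continuous g ->
  (forall x y, agree k x y -> `|g x - g y| <= c) ->
  `|Ig g - \sum_(w : k.-tuple 'I_m.+1) mass w * g (xw w)| <= c.
Proof.
move=> cg hg.
pose f (w : k.-tuple 'I_m.+1) (x : sft A) := g (xw w) * \1_(cylinder A w) x.
have mc w : measurable (cylinder A w : set (borel_sft A)).
  by apply: open_borel; exact: cylinder_open.
have i1 w : integ (\1_(cylinder A w) : sft A -> R).
  apply: measurable_bounded_integrable; first exact: measurableT.
  - by apply: le_lt_trans (probability_le1 _ _) _; rewrite ?ltry.
  - exact: measurable_indic.
  exists 1; split; first exact: num_real.
  by move=> M M1 x _ /=; rewrite indicE ger0_norm// (le_trans _ (ltW M1))// lern1 leq_b1.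
have iff w : integ (f w).
  have := integrableZl measurableT (g (xw w)) (i1 w).
  by apply: eq_integrable => // x _; rewrite /= EFinM.
have [is1 is2] := integral_sum (index_enum (k.-tuple 'I_m.+1)) iff.
have -> : \sum_(w : k.-tuple 'I_m.+1) mass w * g (xw w) =
    Ig (fun x => \sum_(w : k.-tuple 'I_m.+1) f w x).
  rewrite is2; apply: eq_bigr => w _.
  rewrite /f RintegralZl// mulrC; congr (_ * _).
  by rewrite /mass /Rintegral integral_indic// setIT.
apply: integral_dist_le => // [|x]; first exact: continuous_integrable.
have sz : size (pref k x) == k by rewrite size_mkseq.
have f1 : f (Tuple sz) x = g (xw (pref k x)).
  have xin : x \in (cylinder A (pref k x) : set (sft A)).
    by apply: mem_set; apply/cylinder_pref.
  by rewrite /f indicE /= xin mulr1.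
have f0 w : w != Tuple sz -> f w x = 0.
  move=> wx; rewrite /f indicE memNset ?mulr0// => h; move/negP: wx; apply.
  apply/eqP/val_inj => /=; move: h; rewrite /cylinder/= size_tuple.
  by move=> <-.
have -> : \sum_w f w x = g (xw (pref k x)).
  by rewrite (bigD1 (Tuple sz))//= f1 big1 ?addr0// => w /f0.
apply: hg; apply: agree_sym.
by apply/cylinder_pref; apply: xgetPex; exists x; apply/cylinder_pref.
Qed.

End RotationVector.

(** * Nonnegativity at rotation vectors *)

Section LevelNonempty.
Variables (R : realType) (m d : nat) (A : mixing_mx m).
Variables (Phi : 'I_d.+1 -> nat -> sft A -> R) (psi : nat -> sft A -> R).
Variables (C B kappa : R).
Hypotheses (C0 : 0 <= C) (B1 : 1 <= B) (kappa0 : 0 < kappa).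
Hypothesis cPhi : forall j n, (0 < n)%N -> continuous (Phi j n).
Let phi j := norm0 (Phi j).
Hypothesis phi_aa : forall j, aapot C B (phi j).
Hypothesis psi_aa : aapot C B psi.
Hypothesis psiS : forall n x, psi n.+1 x <= psi n x - kappa.
Hypothesis psi_var : forall delta, 0 < delta -> exists2 D, 0 <= D &
  forall n x y, agree n x y -> `|psi n x - psi n y| <= delta * n%:R + D.
Hypothesis phi_var : forall j delta, 0 < delta -> exists2 D, 0 <= D &
  forall n x y, agree n x y -> `|phi j n x - phi j n y| <= delta * n%:R + D.

Lemma point_block (k : nat) (z : sft A) : exists b : block A,
  [/\ #|bidx b| = 1%N, blen b = k & forall f (e : R),
    (forall x, agree k x z -> `|f k x - f k z| <= e) -> approx f b (f k z) e].
Proof.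
have inj : forall i j : unit, agree k z z -> i = j by case=> -[].
exists (@Block m A unit (fun=> z) k inj); split => //; first by rewrite card_unit.
by move=> f e h i x /= xz; exact: h.
Qed.

(** Each tuple of length [k] gives a block of one point, weighted by its mass. Such blocks have
    count 1, so [S = 0] and every rate [- rho] is reached. The weighted average is the integral up
    to variation, hence close to [k * alpha]. *)
Lemma Phi_star_level (mu : probability (borel_sft A) R) : Defs.invariant mu ->
  (0 <= Lambda_ext phi psi (Phi_star Phi mu))%E.
Proof.
move=> mu_inv; set alpha := Phi_star Phi mu.
have B0 : 0 < B by apply: lt_le_trans B1.
apply/(Lambda_ext_ge phi B1 kappa0 psi_aa psiS) => eps eps0.
apply: le_growth_rate => rho rho0; rewrite sub0r.
have [q H] := block_growth C0 B1 kappa0 phi_aa psi_aa psiS.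
pose K := 2 * C + B * q%:R.
have K0 : 0 <= K by rewrite addr_ge0// mulr_ge0// ltW.
pose Q j : R := 1 + `|alpha 0 j| + (B + `|alpha 0 j|) * (2 / kappa).
have Q0 j : 0 <= Q j.
  apply: addr_ge0; first by rewrite addr_ge0.
  by apply: mulr_ge0; [apply: addr_ge0 (normr_ge0 _); exact: ltW|rewrite divr_ge0// ltW].
pose Qs := \sum_j Q j.
have Qs0 : 0 <= Qs by exact: sumr_ge0.
have QQs j : Q j <= Qs by rewrite /Qs (bigD1 j)//= lerDl sumr_ge0.
(* This makes the errors proportional to [k] equal to half of [eps * k]; [kbig] below leaves the
   other half for the constants. *)
pose delta := eps / (2 * (1 + eps + Qs)).
have S0 : 0 < 1 + eps + Qs by rewrite -addrA ltr_pwDl// addr_ge0// ltW.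
have delta0 : 0 < delta by rewrite divr_gt0// mulr_gt0.
have [D [D0 psiD phiD]] := common_var psi_var phi_var delta0.
have [N _ hN] := near_natr (2 * (D + C + (D + K) * (Qs + eps)) / eps + 1).
pose k := N.+1.
have kbig : 2 * (D + C + (D + K) * (Qs + eps)) < eps * k%:R.
  have : 2 * (D + C + (D + K) * (Qs + eps)) / eps + 1 <= k%:R by apply: hN; rewrite /= /k.
  rewrite -lerBrDr ler_pdivrMr// => h; apply: le_lt_trans h _.
  by rewrite [ltRHS]mulrC ltr_pM2r//; lra.
pose xw (w : k.-tuple 'I_m.+1) : sft A := xget point (cylinder A w).
pose mass (w : k.-tuple 'I_m.+1) := fine (mu (cylinder A w)).
have avg g (c : R) : continuous g -> (forall x y, agree k x y -> `|g x - g y| <= c) ->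
  `|\int[mu]_(x in [set: borel_sft A]) g x - \sum_w mass w * g (xw w)| <= c.
  exact: cylinder_average.
have mass0 w : 0 <= mass w by exact: mass_ge0.
have mass1 : \sum_w mass w = 1.
  have c1 (x y : sft A) : agree k x y -> `|1 - 1 : R| <= 0 by rewrite subrr normr0.
  have := avg (fun=> 1) 0 (@cst_continuous (sft A) R 1) c1.
  rewrite Rintegral_cst// mul1r (_ : fine _ = 1); last by have := probability_setT mu; move=> /= ->.
  rewrite normr_le0 subr_eq0 => /eqP h; rewrite [RHS]h.
  by apply: eq_bigr => w _; rewrite mulr1.
have sumK c : \sum_w mass w * c = c by rewrite -mulr_suml mass1 mul1r.
have /choice[blk hblk] := fun w => point_block k (xw w).
have blk1 w : #|bidx (blk w)| = 1%N by have [] := hblk w.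
have blkk w : blen (blk w) = k by have [] := hblk w.
have e0 : 0 <= delta * k%:R + D by rewrite addr_ge0// mulr_ge0// ltW.
apply: growth_rate_ge.
have := H _ blk mass (fun w => psi k (xw w)) (fun=> delta * k%:R + D)
  (fun w => \row_j phi j k (xw w)) alpha eps (- rho) mass0.
have SL : \sum_w mass w * (blen (blk w))%:R = k%:R.
  by rewrite -[RHS]sumK; apply: eq_bigr => w _; rewrite blkk.
have SS : \sum_w mass w * ln #|bidx (blk w)|%:R = 0.
  by rewrite big1// => w _; rewrite blk1 ln1 mulr0.
have Dpos : 0 < delta * k%:R + D + K - \sum_w mass w * psi k (xw w).
  have h1 : \sum_w mass w * psi k (xw w) <= 0.
    apply: sumr_le0 => w _; apply: mulr_ge0_le0 => //.
    have [p0 _ _] := psi_aa; exact: (psi_le0 p0 kappa0 psiS).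
  have h2 : 0 < delta * k%:R by rewrite mulr_gt0.
  by move: h1 h2 D0 K0; clear; lra.
rewrite -/K; cbv zeta; rewrite SL SS sumK; apply => //.
- by move=> w; rewrite blk1.
- by move=> w; have [_ bk h] := hblk w; apply: h => x; exact: psiD.
- by move=> w j; rewrite mxE; have [_ bk h] := hblk w; apply: h => x; exact: phiD.
- move=> j.
  have h1 : `|\sum_w mass w * (\row_j0 phi j0 k (xw w)) 0 j - k%:R * alpha 0 j| <=
      delta * k%:R + D + C.
    rewrite (_ : \sum_w _ = \sum_w mass w * phi j k (xw w)); last first.
      by apply: eq_bigr => w _; rewrite mxE.
    apply: le_trans (ler_distD (\int[mu]_(x in [set: borel_sft A]) phi j k x) _ _) _.
    apply: lerD; last exact: (Phi_star_rate mu_inv C0 cPhi phi_aa).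
    rewrite distrC; apply: avg; last exact: phiD.
    by apply: norm0_continuous => n n0; exact (@cPhi j n n0).
  apply: le_lt_trans (lerD h1 (lexx _)) _; rewrite -/(Q j).
  have h2 : (delta * k%:R + D + K) * Q j <= (delta * k%:R + D + K) * Qs.
    by rewrite ler_wpM2l// addr_ge0.
  have h3 : delta * k%:R * (1 + eps + Qs) = eps * k%:R / 2.
    by rewrite /delta; field; rewrite gt_eqF.
  apply: le_lt_trans (lerD (lexx _) h2) _.
  by move: h3 kbig; clear; lra.
- by rewrite mulNr oppr_lt0 mulr_gt0.
Qed.

End LevelNonempty.

(** * Regularity of Lambda *)

Section Normalisation.
Variables (R : realType) (m d : nat) (A : mixing_mx m).
Variables (Phi : 'I_d.+1 -> nat -> sft A -> R) (psi : nat -> sft A -> R).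

Lemma norm0_word_weight w : word_weight (norm0 psi) w = word_weight psi w.
Proof. by case: w. Qed.

Lemma norm0_level_words alpha n e :
  level_words (fun j => norm0 (Phi j)) (norm0 psi) alpha n e = level_words Phi psi alpha n e.
Proof.
apply/funext => w; apply/propext; rewrite /level_words /ball_words /=.
rewrite !norm0_word_weight.
suff vE x : (size w)%:R^-1 *: vec_potential (fun j => norm0 (Phi j)) (size w) x =
    (size w)%:R^-1 *: vec_potential Phi (size w) x.
  by split=> -[bw [x wx h]]; split=> //; exists x => //; move: h; rewrite vE.
(* For the empty word the inverse of 0 is 0, which cancels the arbitrary value at index 0. *)
case: (size w) => [|n']; first by rewrite invr0 !scale0r.
by congr (_ *: _); apply/rowP => j; rewrite !mxE.
Qed.

Lemma norm0_Lambda_ext alpha :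
  Lambda_ext (fun j => norm0 (Phi j)) (norm0 psi) alpha = Lambda_ext Phi psi alpha.
Proof.
rewrite /Lambda_ext; suff -> : growth_rate (fun j => norm0 (Phi j)) (norm0 psi) alpha =
  growth_rate Phi psi alpha by [].
apply/funext => e; rewrite /growth_rate; apply: congr1; apply/funext => n.
by rewrite norm0_level_words.
Qed.

Lemma common_constants : (forall j, almost_additive (Phi j)) -> neg_almost_additive psi ->
  exists C B kappa : R, [/\ 0 <= C, 1 <= B, 0 < kappa,
    (forall j, aapot C B (norm0 (Phi j))) /\ aapot C B (norm0 psi) &
    forall n x, norm0 psi n.+1 x <= norm0 psi n x - kappa].
Proof.
move=> hPhi [Cp hp hneg].
have [kappa kappa0 hk] := norm0_decr hp hneg.
have [Bp hBp] := norm0_aapot hp.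
have /choice[C hC] := hPhi.
have /choice[B hB] : forall j, exists B, aapot (C j) B (norm0 (Phi j)).
  by move=> j; exact: norm0_aapot (hC j).
have Cp0 : 0 <= Cp by have [? _ _] := hp; exact: ltW.
have C0 j : 0 <= C j by have [? _ _] := hC j; exact: ltW.
have sC j : C j <= \sum_i C i by rewrite (bigD1 j)//= lerDl sumr_ge0.
have sB j : `|B j| <= \sum_i `|B i| by rewrite (bigD1 j)//= lerDl sumr_ge0.
have sC0 : 0 <= \sum_i C i by rewrite sumr_ge0.
have sB0 : 0 <= \sum_i `|B i| by rewrite sumr_ge0.
(* The summand 1 gives [1 <= B], so that the length obeys the same constants as the potentials. *)
exists (Cp + \sum_i C i), (1 + `|Bp| + \sum_i `|B i|), kappa; split => //.
- exact: addr_ge0.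
- by have := normr_ge0 Bp; lra.
split.
  move=> j; apply: aapot_leq (hB j); first by have := sC j; lra.
  by have := sB j; have := ler_norm (B j); have := normr_ge0 Bp; lra.
by apply: aapot_leq hBp; [lra|have := ler_norm Bp; lra].
Qed.

End Normalisation.

Lemma weakly_concave_regular (R : realType) (d : nat) (L : set 'rV[R]_d.+1)
    (h : 'rV[R]_d.+1 -> R) :
  weakly_concave L h -> (forall x, L x -> 0 <= h x) ->
  (forall x e, L x -> 0 < e -> exists2 dl, 0 < dl &
    forall y, L y -> `|y - x| < dl -> h y < h x + e) ->
  (forall u v, segment u v `<=` L -> {within segment u v, continuous h}) /\
  (forall K : set 'rV[R]_d.+1, convex_set K -> K `<=` L ->
     {within rel_interior K, continuous h}) /\
  {within rel_interior L, continuous h} /\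
  (is_polyhedron L -> {within L, continuous h}) /\
  (forall alpha0 alpha1 alphamax : 'rV[R]_d.+1,
     segment alpha0 alpha1 `<=` L -> segment alpha0 alpha1 alphamax ->
     (forall alpha, segment alpha0 alpha1 alpha -> h alpha <= h alphamax) ->
     nonincreasing_along h alphamax alpha0 /\
     nonincreasing_along h alphamax alpha1).
Proof.
move=> wc h0 usc.
have cont S : S `<=` L -> (forall x0, S x0 -> extendable L S x0) ->
    {within S, continuous h}.
  by move=> SL ext; exact: (weakly_concave_continuous wc h0 usc SL ext).
have cri K : K `<=` L -> {within rel_interior K, continuous h}.
  move=> KL; apply: cont; first by move=> x [/KL].
  exact: rel_interior_extendable.
split.
  by move=> u v uvL; apply: cont => //; exact: segment_extendable.
split; first by move=> K _; exact: cri.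
split; first exact: cri.
split; first by move=> pL; apply: cont => //; exact: polyhedron_extendable.
move=> a0 a1 am aL [r + <-] hmax; rewrite /= in_itv/= => /andP[r0 r1].
have seg t : 0 <= t <= 1 -> segment a0 a1 (t *: a0 + (1 - t) *: a1).
  by move=> t01; exists t => //; rewrite /= in_itv.
have t0 t : 0 <= t <= 1 -> segment a0 a1 ((1 - t) *: (r *: a0 + (1 - r) *: a1) + t *: a0).
  move=> /andP[t0 t1].
  have -> : (1 - t) *: (r *: a0 + (1 - r) *: a1) + t *: a0 =
    ((1 - t) * r + t) *: a0 + (1 - ((1 - t) * r + t)) *: a1.
    by apply/rowP => j; rewrite !mxE; ring.
  apply: seg; have h1 : (1 - t) * r <= (1 - t) * 1 by rewrite ler_wpM2l// subr_ge0.
  have h2 : 0 <= (1 - t) * r by rewrite mulr_ge0// subr_ge0.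
  by apply/andP; split; lra.
have t1 t : 0 <= t <= 1 -> segment a0 a1 ((1 - t) *: (r *: a0 + (1 - r) *: a1) + t *: a1).
  move=> /andP[t0' t1].
  have -> : (1 - t) *: (r *: a0 + (1 - r) *: a1) + t *: a1 =
    ((1 - t) * r) *: a0 + (1 - (1 - t) * r) *: a1.
    by apply/rowP => j; rewrite !mxE; ring.
  apply: seg; have h1 : (1 - t) * r <= (1 - t) * 1 by rewrite ler_wpM2l// subr_ge0.
  have h2 : 0 <= (1 - t) * r by rewrite mulr_ge0// subr_ge0.
  by apply/andP; split; lra.
split; apply: weakly_concave_nonincreasing wc _ _ => t t01.
- by apply: aL; exact: t0.
- by apply: hmax; exact: t0.
- by apply: aL; exact: t1.
- by apply: hmax; exact: t1.
Qed.

Theorem proposition2p5 (R : realType) (m d : nat) (A : mixing_mx m)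
    (Phi : 'I_d.+1 -> nat -> sft A -> R) (Psi : nat -> sft A -> R)
    (hPhi : forall j, almost_additive (Phi j))
    (hPsi : neg_almost_additive Psi) :
  let L := L_Phi Phi in
  let Lam := Lambda Phi Psi in
  (forall alpha, L alpha -> Lambda_ext Phi Psi alpha \is a fin_num) /\
  [bounded Lam alpha | alpha in L] /\
  (forall alpha, L alpha -> 0 <= Lam alpha) /\
  weakly_concave L Lam /\
  (forall u v, segment u v `<=` L -> {within segment u v, continuous Lam}) /\
  (forall K : set 'rV[R]_d.+1, convex_set K -> K `<=` L ->
     {within rel_interior K, continuous Lam}) /\
  {within rel_interior L, continuous Lam} /\
  (is_polyhedron L -> {within L, continuous Lam}) /\
  (forall alpha0 alpha1 alphamax : 'rV[R]_d.+1,
     segment alpha0 alpha1 `<=` L -> segment alpha0 alpha1 alphamax ->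
     (forall alpha, segment alpha0 alpha1 alpha -> Lam alpha <= Lam alphamax) ->
     nonincreasing_along Lam alphamax alpha0 /\
     nonincreasing_along Lam alphamax alpha1).
Proof.
move=> L Lam.
have [C [B [kappa [C0 B1 kappa0 [Phi_aa Psi_aa] PsiS]]]] := common_constants hPhi hPsi.
have cPhi j n : (0 < n)%N -> continuous (Phi j n).
  by have [? [_ + _]] := hPhi j; apply.
have cPsi n : (0 < n)%N -> continuous (Psi n).
  by have [? [_ + _] _] := hPsi; apply.
have Psi_var := aapot_var Psi_aa (norm0_unif cPsi).
have Phi_var j := aapot_var (Phi_aa j) (norm0_unif (@cPhi j)).
have extE := norm0_Lambda_ext Phi Psi.
have LamE : Lam = Lambda (fun j => norm0 (Phi j)) (norm0 Psi).
  by apply/funext => alpha; rewrite /Lam /Lambda extE.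
have Lext alpha : L alpha ->
    (0 <= Lambda_ext (fun j => norm0 (Phi j)) (norm0 Psi) alpha)%E.
  move=> [mu mu_inv <-].
  exact: (Phi_star_level C0 B1 kappa0 cPhi Phi_aa Psi_aa PsiS Psi_var Phi_var mu_inv).
clearbody Lam L.
have LamK alpha : L alpha -> Lambda_ext Phi Psi alpha = (Lam alpha)%:E.
  by move=> /Lext; rewrite LamE -extE; exact: (Lambda_extK B1 kappa0 Psi_aa PsiS).
have Lam0 alpha : L alpha -> 0 <= Lam alpha.
  by move=> /Lext; rewrite LamE; exact: (Lambda_ge0 B1 kappa0 Psi_aa PsiS).
have wc : weakly_concave L Lam.
  (* The inequality passes from the set where [Lambda_ext] is nonnegative to its subset [L], since
     membership is asked of the two end points. *)
  have := Lambda_weakly_concave C0 B1 kappa0 Phi_aa Psi_aa PsiS Psi_var Phi_var.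
  rewrite -LamE => -[c c1 hc]; exists c => // alpha beta La Lb.
  by apply: hc; exact: Lext.
have usc x e : L x -> 0 < e -> exists2 dl, 0 < dl &
    forall y, L y -> `|y - x| < dl -> Lam y < Lam x + e.
  move=> Lx e0; rewrite LamE.
  have [dl dl0 h] := Lambda_usc B1 kappa0 Psi_aa PsiS (Lext _ Lx) e0.
  by exists dl => // y /Lext; exact: h.
split; first by move=> alpha /LamK ->.
split.
  exists ((kappa^-1 + 1) * ln m.+2%:R); split; first exact: num_real.
  move=> M hM alpha La /=; rewrite ger0_norm ?Lam0//; apply: le_trans (ltW hM).
  rewrite -lee_fin -LamK// -extE.
  exact: Lambda_ext_bound B1 kappa0 Psi_aa PsiS _.
split; first exact: Lam0.
split; first exact: wc.
exact: weakly_concave_regular.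
Qed.
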